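(* There is a universal constant $C>0$ such that the following holds. Let $\alpha\ge2$ and let $X=(X_1,\dots,X_d)\in\mathbb R^d$ be a random vector with independent components, $\mathbb EX=0$, and $\|X_i\|_{\Psi_\alpha}\le K_i<\infty$. Put $\sigma_{X_i}:=(\mathbb EX_i^2)^{1/2}$. Then for all $s\ge0$: if $\alpha\ge4$, $$\mathbb P\left(\left|\|X\|-\sqrt{\mathbb E\|X\|^2}\right|\ge s\right)\le2\exp\left(-C\max\left\{\frac{s^4}{\sum_{i=1}^dK_i^4},\ \frac{\sum_{i=1}^d\sigma_{X_i}^2}{\sum_{i=1}^dK_i^4}s^2,\ \frac{s^\alpha}{\left(\sum_{i=1}^dK_i^{\frac{2\alpha}{\alpha-2}}\right)^{\frac{\alpha-2}2}},\ \frac{s^{\frac\alpha2}\left(\sum_{i=1}^d\sigma_{X_i}^2\right)^{\frac\alpha4}}{\left(\sum_{i=1}^dK_i^{\frac{2\alpha}{\alpha-2}}\right)^{\frac{\alpha-2}2}}\right\}\right),$$ and if $\alpha\in[2,4]$, $$\mathbb P\left(\left|\|X\|-\sqrt{\mathbb E\|X\|^2}\right|\ge s\right)\le2\exp\left(-C\min\left\{\max\left\{\frac{s^4}{\sum_{i=1}^dK_i^4},\frac{\sum_{i=1}^d\sigma_{X_i}^2}{\sum_{i=1}^dK_i^4}s^2\right\},\ \max\left\{\frac{s^\alpha}{\left(\sum_{i=1}^dK_i^{\frac{2\alpha}{\alpha-2}}\right)^{\frac{\alpha-2}2}},\frac{s^{\frac\alpha2}\left(\sum_{i=1}^d\sig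ma_{X_i}^2\right)^{\frac\alpha4}}{\left(\sum_{i=1}^dK_i^{\frac{2\alpha}{\alpha-2}}\right)^{\frac{\alpha-2}2}}\right\}\right\}\right).$$
   Context: $\|X\|$ is the Euclidean norm of the vector $X$. For a real random variable $Y$ and $\alpha\ge1$, the Orlicz norm is $\|Y\|_{\Psi_\alpha}:=\inf\{u>0:\ \mathbb E\exp((|Y|/u)^\alpha)\le 2\}$. When $\alpha=2$, the quantity $(\sum_{i=1}^dK_i^{2\alpha/(\alpha-2)})^{(\alpha-2)/2}$ is interpreted as its limit $\max_iK_i^2$. *)

(* Defs.v *)
From HB Require Import structures.
From mathcomp Require Import all_boot all_order all_algebra.
From mathcomp Require Import all_classical all_reals all_analysis.

Set Implicit Arguments.
Unset Strict Implicit.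
Unset Printing Implicit Defensive.

Import Order.TTheory GRing.Theory Num.Theory.
Import numFieldNormedType.Exports.

Local Open Scope classical_set_scope.
Local Open Scope ring_scope.

(* The library norm on row vectors is the sup norm. *)
Definition enorm (R : realType) (d : nat) (x : 'rV[R]_d) : R :=
  Num.sqrt (\sum_(i < d) x ord0 i ^+ 2).

(* Valued in \bar R: +oo when no u > 0 is admissible. *)
Definition orlicz_norm (disp : measure_display) (T : measurableType disp)
    (R : realType) (P : probability T R) (alpha : R) (Y : T -> R) : \bar R :=
  ereal_inf [set u%:E | u in [set u : R | 0 < u /\
    ('E_P[(fun w => expR ((`|Y w| / u) `^ alpha))] <= 2%:E)%E]].

(* Mutual independence: the product rule over every subfamily. *)
Definition mutually_independent (disp : measure_display)
    (T : measurableType disp) (R : realType) (P : probability T R)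
    (d : nat) (X : 'I_d -> {RV P >-> R}) : Prop :=
  forall (J : {set 'I_d}) (B : 'I_d -> set R),
    (forall i, measurable (B i)) ->
    P (\bigcap_(i in [set` J]) (X i @^-1` B i)) =
    (\prod_(i in J) P (X i @^-1` B i))%E.

Definition sigma (disp : measure_display) (T : measurableType disp)
    (R : realType) (P : probability T R) (Y : T -> R) : R :=
  Num.sqrt (fine 'E_P[(fun w => Y w ^+ 2)]).

(* (\sum_i K_i^(2 alpha / (alpha - 2)))^((alpha - 2) / 2), which tends to
   max_i K_i^2 as alpha decreases to 2. *)
Definition Kdenom (R : realType) (d : nat) (alpha : R) (K : 'I_d -> R) : R :=
  if alpha == 2 then \big[Num.max/0]_(i < d) K i ^+ 2
  else (\sum_(i < d) K i `^ (2 * alpha / (alpha - 2))) `^ ((alpha - 2) / 2).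

(* Main.v *)
From HB Require Import structures.
Require Import Defs.
From mathcomp Require Import all_boot all_order all_algebra.
From mathcomp Require Import all_classical all_reals all_analysis.
From mathcomp Require Import measurable_realfun.
From mathcomp Require Import ring lra.

Set Implicit Arguments.
Unset Strict Implicit.
Unset Printing Implicit Defensive.

Import Order.TTheory GRing.Theory Num.Theory.
Import numFieldNormedType.Exports.

Local Open Scope classical_set_scope.
Local Open Scope ring_scope.

(** Put b = alpha / 2 >= 1, a_i = K_i^2, S2 = E ||X||^2 and
    t = s * max(s, sqrt S2). Since | ||X||^2 - S2 | equals
    | ||X|| - sqrt S2 | * (||X|| + sqrt S2), a deviation s of the norm forces
    a deviation t of the squared norm (le_sqr_diff), and t^2 and t^b dominate
    the four numerators of the exponents (deviation_scales). The squared norm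
    minus its mean is the sum of the a_i U_i with U_i = (X_i^2 - E X_i^2) / a_i,
    which are independent and centered with E exp(|U_i|^b / 2) <= 4
    (centered_square_exp_moment). So all that matters is a two-scale tail
    bound for such sums, applied to the U_i and to the - U_i: with q the
    conjugate exponent of b, the exponent is governed by t^2 / |a|_2^2 and by
    (t / |a|_q)^b.

    Both bounds are Chernoff bounds (chernoff_independent_sum), and the Laplace
    transform of one U is estimated by integrating a pointwise inequality
    exp(x u) <= A + B u + D exp(|u|^b / 2), whose middle term has integral 0
    (exp_majorized, le_integral_of_bounded_exp). For b <= 2 a quadratic
    majorant for small x and a majorant from Young's inequality for large x
    give the minimum of the two bounds, on taking for the Laplace parameter
    the smaller of those that suit each scale (tail_mixed). At b = 2 both
    scales are the l^2 norm, whence the Gaussian bound for every b >= 2.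

    For b >= 2 the second bound must hold on its own with a constant that does
    not depend on b (tail_power). The Legendre transform that gives exactly
    C (t / |a|_q)^b comes from the estimate
    E exp(x U) <= exp(C (b - 1) y^b), where x = C b y^(b - 1),
    so this has to be proved for all y >= 0 with one C
    (exp_majorized_power). Young's inequality alone leaves an additive
    constant in the exponent, hence three regimes. When y^b is large, Young's
    inequality has a slack proportional to y^b that absorbs the constant. When
    x is small, the quadratic majorant is below the target. In between,
    b is at least a multiple of 1 / C, hence huge: then U is essentially
    bounded by 1 in absolute value, and being centered it is not concentrated
    at 1, so that E exp(x U) <= exp(x - c) for a fixed c > 0, while a tangent
    inequality shows C (b - 1) y^b >= x - C.

    If K_i = 0 then X_i = 0 almost surely, and U_i = 0 because x / 0 = 0. *)

(** * Powers and exponentials of real numbers *)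

Section real_inequalities.
Variable R : realType.
Implicit Types a b u v w x y z m : R.

(** Young's inequality for the product of z and 1. *)
Lemma powR_bernoulli z b : 0 <= z -> 1 <= b -> 1 + b * (z - 1) <= z `^ b.
Proof.
move=> z0; rewrite le_eqVlt => /predU1P[<-|b1].
  by rewrite powRr1// mul1r addrC subrK.
have b0 : 0 < b by lra.
have q0 : 0 < b / (b - 1) by apply: divr_gt0; lra.
have bn : b != 0 by rewrite gt_eqF.
have bn1 : b - 1 != 0 by rewrite subr_eq0 gt_eqF.
have /(conjugate_powR z0 ler01 b0 q0) : b^-1 + (b / (b - 1))^-1 = 1.
  by rewrite invf_div; field.
rewrite powR1 mulr1 invf_div mul1r -(ler_pM2l b0) mulrDr mulrCA divff// mulr1.
rewrite mulrCA divff// mulr1; lra.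
Qed.

(** Bernoulli's inequality for z / m, scaled by m `^ b; at m = 0 it reads
    z <= z for b = 1 and 0 <= z `^ b otherwise. *)
Lemma powR_tangent z m b : 0 <= z -> 0 <= m -> 1 <= b ->
  m `^ b + b * m `^ (b - 1) * (z - m) <= z `^ b.
Proof.
move=> z0 m0 b1; have [->|mn0] := eqVneq m 0.
  have [->|bn1] := eqVneq b 1.
    by rewrite subrr powRr0 !powRr1// add0r !mul1r subr0.
  by rewrite !powR0 ?subr_eq0// ?mulr0 ?mul0r ?addr0 ?powR_ge0// gt_eqF//; lra.
have m_gt0 : 0 < m by rewrite lt_neqAle eq_sym mn0.
have zE : z = m * (z / m) by rewrite mulrCA divff ?mulr1// gt_eqF.
rewrite [in leRHS]zE powRM; [|exact: ltW|exact: divr_ge0 (ltW m_gt0)].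
rewrite -(mulr_powRB1 (ltW m_gt0)); last lra.
have /(ler_wpM2l (powR_ge0 m b)) := powR_bernoulli (divr_ge0 z0 (ltW m_gt0)) b1.
rewrite -(mulr_powRB1 (ltW m_gt0)); last lra.
apply: le_trans; rewrite le_eqVlt; apply/orP; left; apply/eqP.
by field; rewrite gt_eqF.
Qed.

Lemma norm_le_powR u b : 1 <= b -> `|u| <= 1 + `|u| `^ b / b.
Proof.
move=> b1; have := powR_bernoulli (normr_ge0 u) b1.
have b0 : 0 < b by lra.
rewrite -(ler_pM2r (_ : 0 < b^-1)) ?invr_gt0// mulrDl [b * _]mulrC mulfK ?gt_eqF//.
have : 0 < b^-1 by rewrite invr_gt0.
lra.
Qed.

(** Both signs follow from expR v - 1 <= v * expR v, the inequality
    1 - v <= expR (- v) multiplied by expR v. *)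
Lemma expR_le_taylor2 v : expR v <= 1 + v + v ^+ 2 * expR `|v|.
Proof.
have h : expR v - 1 <= v * expR v.
  have := expR_ge1Dx (- v); rewrite -(ler_pM2r (expR_gt0 v)) mulrDl -expRD.
  by rewrite addNr expR0; lra.
have [v0|v0] := lerP 0 v.
  by have := ler_wpM2l v0 h; rewrite ger0_norm// expr2; lra.
have := expR_ge1Dx v; have := expR_gt0 v => e0 e1.
have : 1 <= expR `|v| by rewrite -expR0 ler_expR.
move=> /(ler_wpM2l (sqr_ge0 v)).
have : v * (expR v - 1) <= v * v by rewrite ler_nM2l//; lra.
rewrite -expr2; lra.
Qed.

Lemma sqr_le_expR w : 0 <= w -> w ^+ 2 <= 4 * expR w.
Proof.
move=> w0; have := expR_ge1Dx (w / 2).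
have -> : expR w = expR (w / 2) ^+ 2 by rewrite -expRM_natl; congr expR; lra.
have := expR_gt0 (w / 2); nra.
Qed.

Lemma expR_half_le2 : expR (2^-1) <= 2 :> R.
Proof.
have := expR_ge1Dx (- 2^-1 : R); rewrite expRN => h.
rewrite -[leRHS]invrK -[leLHS]invrK lef_pV2 ?posrE ?invr_gt0 ?expR_gt0//.
lra.
Qed.

Lemma expR4_ge9 : 9 <= expR 4 :> R.
Proof.
have := expR_ge1Dx (2 : R).
have -> : expR 4 = expR 2 ^+ 2 :> R by rewrite -expRM_natl; congr expR; lra.
nra.
Qed.

(** Bernoulli's inequality for expR (w * v) with the exponent w^-1. *)
Lemma expR_scale_le w v : 0 <= w <= 1 -> expR (w * v) <= 1 + w * (expR v - 1).
Proof.
move=> /andP[w0 w1]; have [->|wn0] := eqVneq w 0.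
  by rewrite !mul0r expR0 addr0.
have w_gt0 : 0 < w by rewrite lt_neqAle eq_sym wn0.
have wV1 : 1 <= w^-1 by rewrite invf_ge1.
have := powR_bernoulli (expR_ge0 (w * v)) wV1.
rewrite -expRM mulrAC divff// mul1r.
rewrite -(ler_pM2l w_gt0) mulrDr mulrA divff//; lra.
Qed.

End real_inequalities.

(** * Pointwise majorants of exponentials *)

(** If U is centered and the expectation of expR (`|U| `^ b / 2) is at most 9,
    then integrating this inequality at U bounds the Laplace transform of U at
    x by E. The bound 9 leaves room for passing from the moment with exponent
    b >= 2 (at most 4) to the one with exponent 2 (at most 8). *)
Definition exp_majorized (R : realType) (b x E : R) :=
  exists A B D : R, [/\ 0 <= D,
    forall u, expR (x * u) <= A + B * u + D * expR (`|u| `^ b / 2) &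
    A + 9 * D <= E].

Section majorants.
Variable R : realType.
Implicit Types b u v w x y z m : R.

Lemma norm_half_le b u : 1 <= b -> `|u| / 2 <= 2^-1 + `|u| `^ b / 2.
Proof.
move=> b1; have := norm_le_powR u b1.
suff : `|u| `^ b / b <= `|u| `^ b by lra.
by rewrite ler_pdivrMr ?ler_peMr ?powR_ge0//; lra.
Qed.

(** Second order Taylor bound: for |x| <= 1/4, the remainder
    (x u)^2 expR |x u| is at most a constant times x^2 expR (|u| / 2). *)
Lemma exp_majorized_quadratic b x : 1 <= b -> `|x| <= 4^-1 ->
  exp_majorized b x (expR (128 * 9 * x ^+ 2)).
Proof.
move=> b1 x4; exists 1, x, (128 * x ^+ 2); split.
- by rewrite mulr_ge0// sqr_ge0.
- move=> u; apply: (le_trans (expR_le_taylor2 _)); rewrite lerD2l exprMn.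
  pose w : R := `|u| / 4; have w0 : 0 <= w by rewrite divr_ge0.
  have xuw : expR `|x * u| <= expR w.
    rewrite ler_expR normrM /w mulrC ler_wpM2l//.
  have u2 : u ^+ 2 = 16 * w ^+ 2.
    by rewrite /w exprMn real_normK ?num_real//; field.
  have h1 : expR (w + w) <= 2 * expR (`|u| `^ b / 2).
    apply: le_trans (ler_wpM2r (expR_ge0 _) (expR_half_le2 R)).
    rewrite -expRD ler_expR; have := norm_half_le u b1; rewrite /w; lra.
  rewrite expRD in h1; have h2 := sqr_le_expR w0.
  set V := expR (_ / 2) in h1 *.
  have -> : 128 * x ^+ 2 * V = x ^+ 2 * (128 * V) by ring.
  rewrite -mulrA; apply: ler_wpM2l; [exact: sqr_ge0 | rewrite u2].
  apply: (@le_trans _ _ (16 * w ^+ 2 * expR w)).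
    by rewrite ler_wpM2l// mulr_ge0// sqr_ge0.
  by have := ler_wpM2r (expR_ge0 w) h2; lra.
- by apply: le_trans (expR_ge1Dx _); lra.
Qed.

(** Young's inequality for (4 x) * (|u| / 4). The multiplicative constant 9 is
    absorbed in the factor 5, since 4 x >= 1. *)
Lemma exp_majorized_young b x : 1 < b -> 4^-1 <= x ->
  exp_majorized b x (expR (5 * (4 * x) `^ (b / (b - 1)))).
Proof.
move=> b1 x4; set q := b / (b - 1).
have q0 : 1 < q by rewrite /q ltr_pdivlMr; lra.
exists 0, 0, (expR ((4 * x) `^ q)); split; first exact: expR_ge0.
- move=> u; rewrite mul0r !add0r -expRD ler_expR.
  apply: le_trans (ler_norm _) _; rewrite normrM ger0_norm; last lra.
  have -> : x * `|u| = 4 * x * (`|u| / 4) by field.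
  have bq : q^-1 + b^-1 = 1 by rewrite /q invf_div; field; rewrite gt_eqF; lra.
  have := @conjugate_powR _ (4 * x) (`|u| / 4) q b.
  move=> /(_ _ _ _ _ bq) h; apply: le_trans (h _ _ _ _) _; try lra.
    by rewrite divr_ge0.
  apply: lerD.
    by rewrite ler_pdivrMr ?ler_peMr ?powR_ge0//; lra.
  rewrite powRM//.
  rewrite -mulrA ler_wpM2l ?powR_ge0//.
  have : (4^-1 : R) `^ b <= 4^-1 by apply: ge1r_powR; lra.
  move=> h4; rewrite ler_pdivrMr; last lra.
  lra.
- rewrite add0r.
  have : 1 `^ q <= (4 * x) `^ q by apply: ge0_ler_powR; rewrite ?nnegrE; lra.
  rewrite powR1 => p1.
  apply: le_trans (ler_wpM2r (expR_ge0 _) (expR4_ge9 R)) _.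
  by rewrite -expRD ler_expR; lra.
Qed.

Lemma exp_majorized_le b x E E' : E <= E' ->
  exp_majorized b x E -> exp_majorized b x E'.
Proof.
move=> EE' [A [B [D [D0 AB AD]]]]; exists A, B, D; split=> //.
exact: le_trans EE'.
Qed.

(** The tangent inequality at k y rather than y, with k = 1 - 1 / (2 b). As
    k `^ (b - 1) >= 1/2, this only doubles the coefficient of v `^ b, and it
    gains the term - y `^ b / 4. *)
Lemma powR_young_gain b y v : 2 <= b -> 0 <= y -> 0 <= v ->
  b * y `^ (b - 1) * v <= (b - 1) * y `^ b - y `^ b / 4 + 2 * v `^ b.
Proof.
move=> b2 y0 v0; pose k : R := 1 - (2 * b)^-1.
have bV : b * (2 * b)^-1 = 2^-1 by field; rewrite gt_eqF; lra.
have bV0 : 0 < (2 * b)^-1 by rewrite invr_gt0; lra.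
have bV4 : (2 * b)^-1 <= 4^-1 by rewrite lef_pV2 ?posrE; lra.
have k0 : 0 <= k by rewrite /k; lra.
have b1 : 1 <= b by lra.
have b'1 : 1 <= b - 1 by lra.
have kE : 2^-1 <= k `^ (b - 1).
  have := powR_bernoulli k0 b'1; rewrite {1}/k; lra.
have h := powR_tangent v0 (mulr_ge0 k0 y0) b1.
rewrite -(@mulr_powRB1 _ (k * y)) in h; [|exact: mulr_ge0|lra].
rewrite powRM// in h.
have yE : y `^ b = y * y `^ (b - 1) by rewrite mulr_powRB1//; lra.
set K := k `^ (b - 1) in h kE *; set Y := y `^ (b - 1) in h yE *.
have h2 : K * (b * Y * v) <= v `^ b + K * ((b - 1) * k * (y * Y)).
  by move: h; lra.
have Yy0 : 0 <= y * Y by rewrite mulr_ge0// powR_ge0.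
have h3 : (b - 1) * k <= (b - 1) - 4^-1 by rewrite /k; lra.
have h4 : v `^ b <= K * (2 * v `^ b).
  by have := ler_wpM2r (powR_ge0 v b) kE; lra.
have K0 : 0 < K by lra.
rewrite -(ler_pM2l K0) yE; apply: (le_trans h2); rewrite [leRHS]mulrDr [leRHS]addrC.
apply: lerD => //; rewrite ler_pM2l//; have := ler_wpM2r Yy0 h3; lra.
Qed.

(** The gain C * y `^ b / 4 from powR_young_gain is at least 36 * C, and the
    expectation of expR (4 * C * V) is at most 1 + 4 * C * 9. *)
Lemma exp_majorized_large b y (C : R) : 2 <= b -> 0 <= y -> 144 <= y `^ b ->
  0 <= C -> 8 * C <= 1 ->
  exp_majorized b (C * b * y `^ (b - 1)) (expR (C * (b - 1) * y `^ b)).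
Proof.
move=> b2 y0 y144 C0 C1.
pose E1 := expR (C * ((b - 1) * y `^ b - y `^ b / 4)).
have E10 : 0 <= E1 := expR_ge0 _.
exists E1, 0, (4 * C * E1); split.
- by apply: mulr_ge0 => //; lra.
- move=> u; set V := `|u| `^ b / 2.
  have V0 : 0 <= V by rewrite divr_ge0 ?powR_ge0.
  have h : expR (4 * C * V) <= 1 + 4 * C * (expR V - 1).
    by apply: expR_scale_le; lra.
  apply: (@le_trans _ _ (E1 * expR (4 * C * V))).
    rewrite /E1 -expRD ler_expR.
    apply: (@le_trans _ _ (C * (b * y `^ (b - 1) * `|u|))).
      apply: le_trans (ler_norm _) _; rewrite normrM ger0_norm.
        by rewrite !mulrA.
      by rewrite !mulr_ge0 ?powR_ge0//; lra.
    have := ler_wpM2l C0 (powR_young_gain b2 y0 (normr_ge0 u)).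
    rewrite /V; lra.
  have := ler_wpM2l E10 h; have : 0 <= E1 * C by exact: mulr_ge0.
  lra.
- have h : 1 + 36 * C <= expR (C * y `^ b / 4).
    by apply: le_trans (expR_ge1Dx _); have := ler_wpM2l C0 y144; lra.
  have -> : C * (b - 1) * y `^ b =
    C * ((b - 1) * y `^ b - y `^ b / 4) + C * y `^ b / 4 by field.
  by rewrite expRD -/E1; have := ler_wpM2l E10 h; lra.
Qed.

(** The worst case is y = 1/2, where it says b <= 2 `^ b. *)
Lemma powR_half_le b y : 2 <= b -> 0 <= y <= 2^-1 -> b * y `^ (b - 2) <= 4.
Proof.
move=> b2 /andP[y0 y2].
have b0 : 0 <= b by lra.
have b20 : 0 <= b - 2 by rewrite subr_ge0.
have [h hE] : exists h : R, 2 * h = 1 by exists 2^-1; rewrite divff.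
have h0 : 0 <= h by lra.
have yh : y <= h by lra.
apply: (@le_trans _ _ (b * h `^ (b - 2))).
  by apply: ler_wpM2l => //; apply: ge0_ler_powR.
have hbE : h `^ b = h * (h * h `^ (b - 2)).
  have -> : b - 2 = b - 1 - 1 by rewrite -addrA -opprD.
  by rewrite !mulr_powRB1//; lra.
have h1 : 1 + b * (2 - 1) <= 2 `^ b by apply: powR_bernoulli; lra.
have h2 : 2 `^ b * h `^ b = 1 by rewrite -powRM// hE powR1.
move: h1 h2; rewrite hbE.
move: (2 `^ b) (h `^ (b - 2)) (powR_ge0 h (b - 2)) => p q q0 h1 h2.
have pq : p * q = 4.
  have e : (2 * h) * (2 * h) * (p * q) = 4 * (p * (h * (h * q))) by ring.
  by rewrite hE !mul1r in e; lra.
have := ler_wpM2r q0 h1; lra.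
Qed.

(** With x = C b Y and Z = y Y the right-hand side is at least x y / 2, so that
    one needs x to be at most a small multiple of y. For y >= 1/2 this is the
    smallness of x; for y <= 1/2, x / y = C b Y2 is small because C is. *)
Lemma quadratic_le_power b y (C Y Y2 Z : R) : 2 <= b -> 0 <= y ->
  0 <= C -> 8 * (128 * 9) * C <= 1 -> 0 <= Z -> 0 <= Y ->
  Z = y * Y -> Y = y * Y2 -> (y <= 2^-1 -> b * Y2 <= 4) ->
  4 * (128 * 9) * (C * b * Y) <= 1 ->
  128 * 9 * (C * b * Y) ^+ 2 <= C * (b - 1) * Z.
Proof.
move=> b2 y0 C0 C1 Z0 Y0 ZE YE Y24 x1.
have [x xE] : exists x, x = C * b * Y by eexists.
rewrite -xE in x1 *.
have x0 : 0 <= x by rewrite xE !mulr_ge0//; lra.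
have xy : x * y = C * b * Z by rewrite xE ZE; ring.
have h2 : 2 * (128 * 9) * x <= y.
  have [y2|y2] := lerP 2^-1 y; first lra.
  have := ler_wpM2l (mulr_ge0 C0 y0) (Y24 (ltW y2)).
  have := ler_wpM2l y0 C1.
  rewrite xE YE; lra.
have := ler_wpM2l x0 h2; rewrite xy expr2.
have b20 : 0 <= b - 2 by lra.
have := mulr_ge0 b20 (mulr_ge0 C0 Z0); lra.
Qed.

Lemma exp_majorized_small b y (C : R) : 2 <= b -> 0 <= y ->
  0 <= C -> 8 * (128 * 9) * C <= 1 -> 4 * (128 * 9) * (C * b * y `^ (b - 1)) <= 1 ->
  exp_majorized b (C * b * y `^ (b - 1)) (expR (C * (b - 1) * y `^ b)).
Proof.
move=> b2 y0 C0 C1 x1.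
have x0 : 0 <= C * b * y `^ (b - 1).
  by rewrite !mulr_ge0 ?powR_ge0//; lra.
apply: (@exp_majorized_le _ _ (expR (128 * 9 * (C * b * y `^ (b - 1)) ^+ 2))).
  rewrite ler_expR.
  apply: (@quadratic_le_power b y C _ (y `^ (b - 2))); rewrite ?powR_ge0//.
  - by rewrite mulr_powRB1//; lra.
  - have -> : b - 2 = b - 1 - 1 by rewrite -addrA -opprD.
    by rewrite mulr_powRB1//; lra.
  - by move=> y2; apply: powR_half_le => //; rewrite y0.
apply: exp_majorized_quadratic; first lra.
by rewrite ger0_norm//; move: (C * b * _) x1 => x; lra.
Qed.

(** Convexity of expR between - x and x. *)
Lemma exp_chord x w : 0 <= x -> -1 <= w <= 1 ->
  expR (x * w) <= expR (- x) + (1 + w) / 2 * (expR x - expR (- x)).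
Proof.
move=> x0 /andP[w0 w1].
have -> : x * w = - x + (1 + w) / 2 * (x + x) by field.
rewrite expRD.
have h : expR ((1 + w) / 2 * (x + x)) <= 1 + (1 + w) / 2 * (expR (x + x) - 1).
  by apply: expR_scale_le; lra.
have := ler_wpM2l (expR_ge0 (- x)) h; rewrite expRD.
have : expR (- x) * expR x = 1 by rewrite -expRD addNr expR0.
set p := expR x; set q := expR (- x) => pq.
have -> : q * (1 + (1 + w) / 2 * (p * p - 1)) =
  q + (1 + w) / 2 * (q * p * p - q) by ring.
by rewrite pq mul1r.
Qed.

Lemma clip_approx b u : 1 <= b ->
  exists2 w, -1 <= w <= 1 & `|u - w| <= `|u| `^ b / b.
Proof.
move=> b1; have h := norm_le_powR u b1.
have r0 : 0 <= `|u| `^ b / b by rewrite divr_ge0 ?powR_ge0//; lra.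
have [u1|u1] := lerP `|u| 1.
  by exists u; [rewrite -ler_norml|rewrite subrr normr0].
have [u0|u0] := lerP 0 u.
  rewrite (ger0_norm u0) in h u1 r0 *.
  by exists 1; [lra|rewrite ger0_norm; lra].
rewrite (ltr0_norm u0) in h u1 r0 *.
by exists (-1); [lra|rewrite ler0_norm; lra].
Qed.

(** Here b is at least of order 1 / C, because x = C b y `^ (b - 1) is bounded
    below while y `^ (b - 1) <= 144. Replace u by its truncation w in [-1, 1]:
    the error is at most |u| `^ b / b, which costs O(C) in expectation both in
    the exponent and in the mean of w. As w is then almost centered, the chord
    bound for expR (x * w) gives about (expR x + expR (- x)) / 2, a fixed factor
    below expR x, whereas the target is at least expR (x - C). *)
Lemma exp_majorized_middle b y (C : R) : 2 <= b -> 0 <= y -> y `^ b <= 144 ->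
  0 < C -> C * (100 * 100 * 100 * 100 * 100 * 100) <= 1 ->
  1 <= 4 * (128 * 9) * (C * b * y `^ (b - 1)) ->
  exp_majorized b (C * b * y `^ (b - 1)) (expR (C * (b - 1) * y `^ b)).
Proof.
move=> b2 y0 y144 C0 C1 x0; have b0 : 0 < b by lra.
have y'0 : 0 <= y `^ (b - 1) := powR_ge0 _ _.
have y'144 : y `^ (b - 1) <= 144.
  have [y1|y1] := lerP 1 y.
    by apply: le_trans y144; apply: ler_powR => //; lra.
  apply: (@le_trans _ _ (1 `^ (b - 1))); last by rewrite powR1; lra.
  by apply: ge0_ler_powR; rewrite ?nnegrE; lra.
have tang : y `^ b + b * y `^ (b - 1) * (1 - y) <= 1.
  by have := @powR_tangent R 1 y b; rewrite powR1; apply => //; lra.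
have yE : y `^ b = y * y `^ (b - 1) by rewrite mulr_powRB1.
set x := C * b * _ in x0 *.
have xb : x / b = C * y `^ (b - 1) by rewrite /x; field; rewrite gt_eqF.
have x_ge0 : 0 <= x by lra.
(* The target is not smaller than expR (x - C). *)
have xE : x - C * (b - 1) * y `^ b <= C.
  have := ler_wpM2l (ltW C0) tang; rewrite /x yE; lra.
have bV0 : 0 < b^-1 by rewrite invr_gt0.
have bVC : b^-1 <= 144 * (4 * (128 * 9)) * C.
  rewrite -[leLHS]mul1r ler_pdivrMr//; apply: (le_trans x0).
  have := ler_wpM2l (mulr_ge0 (ltW C0) (ltW b0)) y'144; rewrite /x; lra.
have th0 : 0 <= 2 * (x / b) by rewrite xb mulr_ge0// mulr_ge0// ltW.
have thC : 2 * (x / b) <= 288 * C.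
  by rewrite xb; have := ler_wpM2l (ltW C0) y'144; lra.
have th1 : 2 * (x / b) <= 1 by lra.
have ex0 : 0 < expR x := expR_gt0 x.
have exN : expR (- x) <= expR x by rewrite ler_expR; lra.
have exN0 : 0 < expR (- x) := expR_gt0 _.
exists ((expR x + expR (- x)) / 2), ((expR x - expR (- x)) / 2),
  (expR x * (b^-1 + 2 * (x / b))); split.
- by apply: mulr_ge0; lra.
- move=> u; set V := `|u| `^ b / 2.
  have V0 : 0 <= V by rewrite divr_ge0 ?powR_ge0.
  have VE : V <= expR V by have := expR_ge1Dx V; lra.
  have b1 : 1 <= b by lra.
  have [w w1] := clip_approx u b1.
  have -> : `|u| `^ b / b = 2 * V * b^-1 by rewrite /V; field; rewrite gt_eqF.
  set r := 2 * V * b^-1; rewrite ler_norml => /andP[uw1 uw2].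
  have e1 : expR (x * u) <= expR (x * w) * expR (2 * (x / b) * V).
    rewrite -expRD ler_expR.
    have := ler_wpM2l x_ge0 uw2; rewrite /r; lra.
  have e2 : expR (2 * (x / b) * V) <= 1 + 2 * (x / b) * (expR V - 1).
    by apply: expR_scale_le; rewrite th0.
  have e3 := exp_chord x_ge0 w1.
  have e4 : expR (x * w) <= expR x.
    by rewrite ler_expR -[leRHS]mulr1 ler_wpM2l//; lra.
  have e5 := ler_wpM2l (expR_ge0 (x * w)) e2.
  have e6 : expR (x * w) * (2 * (x / b) * expR V) <=
            expR x * (2 * (x / b) * expR V).
    by rewrite ler_wpM2r// mulr_ge0// expR_ge0.
  have e7 : 0 <= expR (x * w) * (2 * (x / b)) by rewrite mulr_ge0// expR_ge0.
  have dx0 : 0 <= expR x - expR (- x) by lra.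
  have e8 : (1 + w) / 2 * (expR x - expR (- x)) <=
            (1 + (u + r)) / 2 * (expR x - expR (- x)).
    by rewrite ler_wpM2r//; lra.
  have e9 : r / 2 * (expR x - expR (- x)) <= b^-1 * expR V * expR x.
    apply: ler_pM => //; last lra.
      by rewrite divr_ge0// /r !mulr_ge0// ltW.
    by rewrite /r; have := ler_wpM2l (ltW bV0) VE; lra.
  apply: (le_trans e1); apply: (le_trans e5).
  move: e3 e6 e7 e8 e9; set p := expR x; set q := expR (- x).
  set W := expR (x * w); set E := expR V; set th := 2 * (x / b).
  lra.
- have [dl dlE] : exists dl : R, dl * (4 * (128 * 9)) = 1.
    by exists (4 * (128 * 9))^-1; rewrite mulVf.
  have e1 : expR (- (x + x)) <= 1 - dl.
    have dl1 : 0 <= 1 - dl by lra.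
    rewrite expRN -[leLHS]mul1r ler_pdivrMr ?expR_gt0//.
    apply: le_trans (ler_wpM2l dl1 (expR_ge1Dx (x + x))).
    have xdl : dl <= x by lra.
    have := ler_wpM2l dl1 xdl; nra.
  have e2 : expR (- x) = expR x * expR (- (x + x)).
    by rewrite -expRD; congr expR; ring.
  have -> : C * (b - 1) * y `^ b = x + (C * (b - 1) * y `^ b - x) by ring.
  rewrite expRD e2.
  apply: (@le_trans _ _ (expR x * ((1 + expR (- (x + x))) / 2 +
    9 * (b^-1 + 2 * (x / b))))); first lra.
  rewrite ler_pM2l//; apply: le_trans (expR_ge1Dx _); lra.
Qed.

(** As a function of x = C b y `^ (b - 1), the exponent C (b - 1) y `^ b is the
    Legendre transform of t |-> C t `^ b, and C is the same for all b. *)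
Lemma exp_majorized_power b y (C : R) : 2 <= b -> 0 <= y ->
  0 < C -> C * (100 * 100 * 100 * 100 * 100 * 100) <= 1 ->
  exp_majorized b (C * b * y `^ (b - 1)) (expR (C * (b - 1) * y `^ b)).
Proof.
move=> b2 y0 C0 C1.
have [y144|y144] := lerP 144 (y `^ b).
  by apply: exp_majorized_large => //; lra.
have [x0|x0] := lerP (4 * (128 * 9) * (C * b * y `^ (b - 1))) 1.
  by apply: exp_majorized_small => //; lra.
by apply: exp_majorized_middle => //; exact: ltW.
Qed.

End majorants.

(** * Products of functions of independent variables *)

(** If E[G 1_B(Y)] = c E[1_B(Y)] for all B, then E[G f(Y)] = c E[f(Y)] for all
    nonnegative f, first for simple functions, then by monotone convergence. *)
Section weighted_integral.
Local Open Scope ereal_scope.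
Context disp (T : measurableType disp) (R : realType).
Variable mu : {measure set T -> \bar R}.
Variables (G Y : T -> R) (c : \bar R).
Hypotheses (mG : measurable_fun setT G) (mY : measurable_fun setT Y).
Hypotheses (G0 : forall w, (0 <= G w)%R) (c0 : 0 <= c) (cfin : c \is a fin_num).
Hypothesis GY_indic : forall B, measurable B ->
  \int[mu]_w (G w * \1_B (Y w))%:E = c * \int[mu]_w (\1_B (Y w))%:E.

Import HBNNSimple.

Lemma weighted_integral_nnsfun (h : {nnsfun R >-> R}) :
  \int[mu]_w (G w * h (Y w))%:E = c * \int[mu]_w (h (Y w))%:E.
Proof.
have mhY r : measurable_fun setT (fun w => \1_(h @^-1` [set r]) (Y w) : R).
  by apply: measurableT_comp mY; exact: measurable_indic.
have hr0 r w : (0 <= r * \1_(h @^-1` [set r]) (Y w))%R.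
  exact: nnfun_muleindic_ge0.
have h1 w : (G w * h (Y w))%:E = \sum_(r \in range h)
    r%:E * (G w * \1_(h @^-1` [set r]) (Y w))%:E.
  rewrite EFinM fimfunE -fsumEFin// ge0_mule_fsumr//; last first.
    by move=> r; rewrite lee_fin; exact: hr0.
  by apply: eq_fsbigr => r _; rewrite !EFinM muleCA.
have h2 w : (h (Y w))%:E = \sum_(r \in range h)
    r%:E * (\1_(h @^-1` [set r]) (Y w))%:E.
  by rewrite fimfunE -fsumEFin//.
have int r (F : T -> R) : measurable_fun setT F -> (forall w, (0 <= F w)%R) ->
    range h r -> \int[mu]_w (r%:E * (F w)%:E) = r%:E * \int[mu]_w (F w)%:E.
  move=> mF F0 [x _ <-]; rewrite ge0_integralZl//.
  - by apply/measurable_EFinP.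
  - by move=> w _; rewrite lee_fin.
  - by rewrite lee_fin.
under eq_integral do rewrite h1.
under [in RHS]eq_integral do rewrite h2.
rewrite ge0_integral_fsum//; last 2 first.
- move=> r; apply/measurable_EFinP; apply: measurable_funM => //.
  exact: measurable_funM.
- move=> r w _; rewrite -EFinM lee_fin mulrCA mulr_ge0//.
rewrite ge0_integral_fsum//; last 2 first.
- by move=> r; apply/measurable_EFinP; apply: measurable_funM => //.
- by move=> r w _; rewrite -EFinM lee_fin.
rewrite ge0_mule_fsumr; last first.
  by move=> r; apply: integral_ge0 => w _; rewrite -EFinM lee_fin.
apply: eq_fsbigr => r /set_mem hr.
rewrite int//; last 2 first.
- exact: measurable_funM.
- by move=> w; rewrite mulr_ge0// indicE.
rewrite int//.
by rewrite GY_indic// muleCA.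
Qed.

Lemma weighted_integral (f : R -> R) :
  measurable_fun setT f -> (forall x, (0 <= f x)%R) ->
  \int[mu]_w (G w * f (Y w))%:E = c * \int[mu]_w (f (Y w))%:E.
Proof.
move=> mf f0.
have mEf : measurable_fun setT (EFin \o f) by exact/measurable_EFinP.
pose h := nnsfun_approx measurableT mEf.
have hcvg x : (h n x)%:E @[n --> \oo] --> (f x)%:E.
  by apply: (@cvg_nnsfun_approx _ _ _ _ measurableT _ mEf) => // y _; rewrite lee_fin.
have hY n : measurable_fun setT (fun w => h n (Y w)).
  by apply: measurableT_comp mY => //.
have nd x : nondecreasing_seq (fun n => h n x).
  by move=> m n mn; apply/lefP/nd_nnsfun_approx.
have e1 : \int[mu]_w (f (Y w))%:E = limn (fun n => \int[mu]_w (h n (Y w))%:E).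
  rewrite -monotone_convergence//.
  - by apply: eq_integral => w _; apply/esym/cvg_lim.
  - by move=> n; exact/measurable_EFinP.
  - by move=> n w _; rewrite lee_fin.
  - by move=> w _ m n mn; rewrite lee_fin; exact: nd.
have e2 : \int[mu]_w (G w * f (Y w))%:E =
    limn (fun n => \int[mu]_w (G w * h n (Y w))%:E).
  rewrite -monotone_convergence//.
  - apply: eq_integral => w _; apply/esym/cvg_lim => //.
    under eq_fun do rewrite EFinM.
    by rewrite EFinM; apply: cvgeZl.
  - by move=> n; apply/measurable_EFinP; exact: measurable_funM.
  - by move=> n w _; rewrite lee_fin mulr_ge0.
  - by move=> w _ m n mn; rewrite lee_fin ler_wpM2l//; exact: nd.
rewrite e2; under eq_fun do rewrite weighted_integral_nnsfun.
rewrite e1; apply/cvg_lim => //; apply: cvgeZl => //.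
apply: ereal_nondecreasing_is_cvgn => m n mn; apply: ge0_le_integral => //.
- by move=> w _; rewrite lee_fin.
- exact/measurable_EFinP.
- exact/measurable_EFinP.
- by move=> w _; rewrite lee_fin; exact: nd.
Qed.

End weighted_integral.

Section independence.
Local Open Scope ereal_scope.
Context disp (T : measurableType disp) (R : realType) (P : probability T R).
Variables (d : nat) (X : 'I_d -> {RV P >-> R}).
Hypothesis Xindep : mutually_independent X.

Lemma expectation_prod_indicators (B : 'I_d -> set R) :
  (forall i, measurable (B i)) ->
  \int[P]_w (\prod_i (\1_(B i) (X i w) : R))%:E =
  \prod_i \int[P]_w (\1_(B i) (X i w))%:E.
Proof.
move=> mB; have mXB i : measurable (X i @^-1` B i).
  exact: measurable_funPTI.
have -> : \prod_i \int[P]_w (\1_(B i) (X i w))%:E =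
    \prod_(i in [set: 'I_d]%SET) P (X i @^-1` B i).
  apply: eq_big => [i|i _]; first by rewrite inE.
  by have := integral_indic P measurableT (mXB i); rewrite setIT => <-.
rewrite -Xindep// -[in RHS](setIT (\bigcap_(i in _) _)) -integral_indic//; last first.
  by apply: fin_bigcap_measurable => //; exact: finite_finset.
apply: eq_integral => w _; congr EFin; rewrite indicE.
case: (boolP (w \in _)) => [/set_mem wB|/negP wB].
  by rewrite big1// => i _; rewrite indicE mem_set//; apply: wB; rewrite /= inE.
have [i iB] : exists i, ~ B i (X i w).
  apply: contrapT => h; apply: wB; apply/mem_set => i _ /=.
  by apply: contrapT => h'; apply: h; exists i.
by rewrite (bigD1 i)//= indicE memNset// mul0r.
Qed.

(** Induction on the number of factors that are not indicators: the product of
    all the other factors is the weight G of weighted_integral. Finiteness of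
    the expectations makes the constant c finite. *)
Lemma expectation_prod (g : 'I_d -> R -> R) :
  (forall i, measurable_fun setT (g i)) -> (forall i x, (0 <= g i x)%R) ->
  (forall i, \int[P]_w (g i (X i w))%:E < +oo) ->
  \int[P]_w (\prod_i g i (X i w))%:E = \prod_i \int[P]_w (g i (X i w))%:E.
Proof.
suff H n : forall g : 'I_d -> R -> R,
    (forall i, measurable_fun setT (g i)) -> (forall i x, (0 <= g i x)%R) ->
    (forall i, \int[P]_w (g i (X i w))%:E < +oo) ->
    (forall i : 'I_d, (n <= i)%N -> exists2 B, measurable B & g i = \1_B) ->
    \int[P]_w (\prod_i g i (X i w))%:E = \prod_i \int[P]_w (g i (X i w))%:E.
  by move=> mg g0 gfin; apply: (H d) => // i; rewrite leqNgt ltn_ord.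
elim: n => [|n IHn] {}g mg g0 gfin gB.
  have /choice[B hB] : forall i, exists B, measurable B /\ g i = \1_B.
    by move=> i; have [//|B mB gE] := gB i; exists B.
  have gE : g = fun i => \1_(B i) by apply/funext => i; case: (hB i).
  by rewrite gE; apply: expectation_prod_indicators => i; case: (hB i).
have [dn|nd] := leqP d n.
  apply: IHn => // i ni; have := leq_ltn_trans ni (ltn_ord i).
  by rewrite ltnNge dn.
(* By the induction hypothesis the factor number n may be any indicator. *)
pose k := Ordinal nd; rewrite (bigD1 k)//= muleC.
pose c := \prod_(i < d | i != k) \int[P]_w (g i (X i w))%:E.
pose G w := (\prod_(i < d | i != k) g i (X i w))%R.
have int0 i : 0 <= \int[P]_w (g i (X i w))%:E.
  by apply: integral_ge0 => w _; rewrite lee_fin.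
have c0 : 0 <= c by apply: prode_ge0.
have cfin : c \is a fin_num.
  by apply: prode_fin_num => i _; rewrite ge0_fin_numE.
under eq_integral do rewrite (bigD1 k)//= mulrC.
apply: (@weighted_integral _ _ _ P G (X k)) => //.
- rewrite /G; under eq_fun do rewrite -big_filter.
  by apply: measurable_prod => i _; exact: measurableT_comp.
- by move=> w; apply: prodr_ge0.
move=> B mB.
pose g' i := if i == k then \1_B : R -> R else g i.
have g'k i : i != k -> g' i = g i by rewrite /g' => /negbTE ->.
have g'B : g' k = \1_B by rewrite /g' eqxx.
have -> : \int[P]_w (G w * \1_B (X k w))%:E = \int[P]_w (\prod_i g' i (X i w))%:E.
  apply: eq_integral => w _; congr EFin.
  rewrite [RHS](bigD1 k)//= g'B mulrC; congr (_ * _)%R.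
  by apply: eq_bigr => i ik; rewrite g'k.
rewrite IHn.
- rewrite [LHS](bigD1 k)//= g'B muleC; congr (_ * _).
  by apply: eq_bigr => i ik; rewrite g'k.
- move=> i; rewrite /g'; case: ifP => // _; exact: measurable_indic.
- by move=> i x; rewrite /g'; case: ifP => // _; rewrite indicE.
- move=> i; rewrite /g'; case: ifP => // _.
  apply: (@le_lt_trans _ _ (\int[P]_w (cst 1 w))).
    apply: ge0_le_integral => //.
    + apply/measurable_EFinP.
      by apply: (@measurableT_comp _ _ _ _ _ _ (\1_B : R -> R)) => //;
        exact: measurable_indic.
    + by move=> w _; rewrite lee_fin indicE; case: (_ \in _).
  rewrite integral_cst// mul1e.
  by apply: (le_lt_trans (probability_le1 P measurableT)); rewrite ltry.
- move=> i ni; have [->|ik] := eqVneq i k; first by exists B.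
  rewrite g'k//; apply: gB; rewrite ltn_neqAle ni andbT.
  by apply: contra ik => /eqP ni'; apply/eqP/val_inj.
Qed.
End independence.

(** * From exponential moments to tails of sums *)

Section moment_bound.
Local Open Scope ereal_scope.
Context disp (T : measurableType disp) (R : realType) (P : probability T R).

Lemma ge0_integrable (f : T -> R) : measurable_fun setT f ->
  (forall w, (0 <= f w)%R) -> \int[P]_w (f w)%:E < +oo ->
  P.-integrable setT (EFin \o f).
Proof.
move=> mf f0 foo; apply/integrableP; split; first exact/measurable_EFinP.
apply: le_lt_trans foo; apply: ge0_le_integral => //.
- by apply: measurableT_comp => //; exact/measurable_EFinP.
- exact/measurable_EFinP.
- by move=> w _ /=; rewrite lee_fin ger0_norm.
Qed.

Lemma measurable_expR_powR (f : T -> R) (p c : R) : measurable_fun setT f ->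
  measurable_fun setT (fun w => expR (f w `^ p / c)).
Proof.
move=> mf; apply: measurableT_comp => //; apply: measurable_funM => //.
exact: (measurableT_comp (measurable_powR p)).
Qed.

Lemma integral_affine (A B : R) (U : T -> R) (m : R) :
  P.-integrable setT (EFin \o U) -> \int[P]_w (U w)%:E = m%:E ->
  P.-integrable setT (fun w => (A + B * U w)%:E) /\
  \int[P]_w (A + B * U w)%:E = (A + B * m)%:E.
Proof.
move=> iU Um; have iA : P.-integrable setT (EFin \o cst A).
  exact: finite_measure_integrable_cst.
have iB : P.-integrable setT (fun w => B%:E * (U w)%:E) by exact: integrableZl.
have -> : (fun w => (A + B * U w)%:E) = (fun w => A%:E + B%:E * (U w)%:E).
  by apply/funext => w; rewrite EFinD EFinM.
split; first exact: integrableD.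
rewrite integralD//= integralZl// Um integral_cst//.
set p := (X in A%:E * X); have -> : p = 1 by exact: probability_setT.
by rewrite mule1 -EFinM -EFinD.
Qed.

Lemma le_integral_of_bounded_exp (U : T -> R) (b x E : R) :
  P.-integrable setT (EFin \o U) -> \int[P]_w (U w)%:E = 0 ->
  \int[P]_w (expR (`|U w| `^ b / 2))%:E <= 9%:E ->
  exp_majorized b x E -> \int[P]_w (expR (x * U w))%:E <= E%:E.
Proof.
move=> iU U0 U9 [A [B [D [D0 AB ADE]]]].
have mU : measurable_fun setT U by apply/measurable_EFinP; case/integrableP: iU.
have mV : measurable_fun setT (fun w => expR (`|U w| `^ b / 2)).
  by apply: measurable_expR_powR; exact: measurableT_comp.
have [iAB ABE] := integral_affine A B iU U0.
have iV : P.-integrable setT (fun w => (expR (`|U w| `^ b / 2))%:E).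
  by apply: ge0_integrable => //; apply: (le_lt_trans U9); rewrite ltry.
apply: (@le_trans _ _ (\int[P]_w ((A + B * U w)%:E + D%:E * (expR (`|U w| `^ b / 2))%:E))).
  apply: ge0_le_integral => //.
  - by apply/measurable_EFinP; apply: measurableT_comp => //; exact: measurable_funM.
  - apply: emeasurable_funD; first by case/integrableP: iAB.
    by apply: emeasurable_funM => //; exact/measurable_EFinP.
  - by move=> w _; rewrite -EFinM -EFinD lee_fin.
rewrite integralD//; last exact: integrableZl.
rewrite ABE integralZl// mulr0 addr0.
apply: (@le_trans _ _ (A%:E + D%:E * 9%:E)).
  by rewrite leeD2l// lee_wpmul2l// lee_fin.
by rewrite -EFinM -EFinD lee_fin mulrC.
Qed.

End moment_bound.

Section chernoff_sum.
Local Open Scope ereal_scope.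
Context disp (T : measurableType disp) (R : realType) (P : probability T R).
Variables (d : nat) (X : 'I_d -> {RV P >-> R}).
Hypothesis Xindep : mutually_independent X.

Lemma chernoff_independent_sum (g : 'I_d -> R -> R) (a e : 'I_d -> R)
    (l t : R) :
  (forall i, measurable_fun setT (g i)) -> (0 < l)%R ->
  (forall i, \int[P]_w (expR (l * a i * g i (X i w)))%:E <= (expR (e i))%:E) ->
  P [set w | t <= \sum_i a i * g i (X i w)]%R <=
  (expR (\sum_i e i - l * t))%:E.
Proof.
move=> mg l0 he.
have mS : measurable_fun setT (fun w => \sum_i a i * g i (X i w))%R.
  apply: measurable_sum => i; apply: measurable_funM => //.
  exact: measurableT_comp.
pose S : {RV P >-> R} := HB.pack (fun w => \sum_i a i * g i (X i w))%R
  (isMeasurableFun.Build _ _ _ _ _ mS).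
apply: (le_trans (chernoff S t l0)).
rewrite expRD EFinM lee_wpmul2r ?lee_fin ?expR_ge0//.
rewrite /mmt_gen_fun unlock /=.
have mexp i : measurable_fun setT (fun y => expR (l * a i * g i y)).
  by apply: measurableT_comp => //; exact: measurable_funM.
have -> : \int[P]_w (expR ((\sum_i a i * g i (X i w)) * l))%:E =
    \int[P]_w (\prod_i expR (l * a i * g i (X i w)))%:E.
  apply: eq_integral => w _; rewrite -expR_sum mulr_suml.
  by congr (expR _)%:E; apply: eq_bigr => i _; rewrite mulrC mulrA.
rewrite (expectation_prod Xindep (g := fun i y => expR (l * a i * g i y)))//.
  rewrite expR_sum -prodEFin.
  suff /andP[] : 0 <= \prod_i \int[P]_w (expR (l * a i * g i (X i w)))%:E <=
      \prod_i (expR (e i))%:E by [].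
  apply: (big_ind2 (fun x y => 0 <= x <= y)) => [|x1 x2 y1 y2|i _].
  - by rewrite lee01 lexx.
  - move=> /andP[x10 x12] /andP[y10 y12].
    by rewrite mule_ge0//= lee_pmul.
  - by rewrite he andbT; apply: integral_ge0 => w _; rewrite lee_fin expR_ge0.
- by move=> i; apply: le_lt_trans (he i) _; rewrite ltry.
Qed.

End chernoff_sum.

(** * Tails of weighted sums of centered variables *)

(** The b-th power of the norm of a with exponent b / (b - 1), the maximum
    norm when b = 1. *)
Definition dual_denom (R : realType) (d : nat) (b : R) (a : 'I_d -> R) : R :=
  if b == 1 then \big[Num.max/0]_(i < d) a i
  else (\sum_(i < d) a i `^ (b / (b - 1))) `^ (b - 1).

Lemma powR_div (R : realType) (x y r : R) : 0 <= x -> 0 <= y ->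
  (x / y) `^ r = x `^ r / y `^ r.
Proof.
by move=> x0 y0; rewrite powRM ?invr_ge0// -powR_inv1// -powRrM mulN1r powRN.
Qed.

Section tails.
Context disp (T : measurableType disp) (R : realType) (P : probability T R).
Variables (d : nat) (X : 'I_d -> {RV P >-> R}).
Hypothesis Xindep : mutually_independent X.
Variables (b : R) (g : 'I_d -> R -> R) (a : 'I_d -> R) (t : R).
Hypothesis mg : forall i, measurable_fun setT (g i).
Hypothesis g_mgf : forall i x E, exp_majorized b x E ->
  (\int[P]_w (expR (x * g i (X i w)))%:E <= E%:E)%E.
Hypothesis a0 : forall i, 0 <= a i.
Hypothesis t0 : 0 < t.

(** The Laplace parameter l = C b (t / S) `^ (b - 1) makes each l * a i of the
    form C b (y i) `^ (b - 1), and then both l * t and the sum of the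
    C (b - 1) (y i) `^ b are multiples of C t `^ b / S `^ (b - 1), by factors
    b and b - 1. *)
Lemma tail_power (C : R) : 2 <= b ->
  0 < C -> C * (100 * 100 * 100 * 100 * 100 * 100) <= 1 ->
  0 < \sum_i a i `^ (b / (b - 1)) ->
  (P [set w | (t <= \sum_i a i * g i (X i w))%R] <=
   (expR (- (C * (t `^ b / dual_denom b a))))%:E)%E.
Proof.
move=> b2 C0 C1; rewrite /dual_denom gt_eqF; last lra.
set S := \sum_i _ => S0.
have b'0 : 0 < b - 1 by lra.
have tS0 : 0 <= t / S by rewrite divr_ge0// ltW.
(* The equality case of Hoelder's inequality between a and y, normalized by
   \sum_i a i * y i = t. *)
pose y i := t / S * a i `^ (b - 1)^-1.
have y0 i : 0 <= y i by rewrite mulr_ge0// powR_ge0.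
have yE i : y i `^ (b - 1) = (t / S) `^ (b - 1) * a i.
  by rewrite /y [LHS]powRM ?powR_ge0// -powRrM mulVf ?gt_eqF// powRr1.
pose W := t * (t / S) `^ (b - 1).
have WE : W = t `^ b / S `^ (b - 1).
  by rewrite /W powR_div ?ltW// mulrA mulr_powRB1// ?ltW//; lra.
have tSb : (t / S) `^ b = t / S * (t / S) `^ (b - 1).
  by rewrite mulr_powRB1//; lra.
have yS : \sum_i y i `^ b = W.
  have yb i : y i `^ b = (t / S) `^ b * a i `^ (b / (b - 1)).
    by rewrite /y [LHS]powRM ?powR_ge0// -powRrM [_^-1 * b]mulrC.
  under eq_bigr do rewrite yb.
  by rewrite -mulr_sumr -/S tSb /W; field; rewrite gt_eqF.
have l0 : 0 < C * b * (t / S) `^ (b - 1).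
  by rewrite !mulr_gt0 ?powR_gt0 ?divr_gt0//; lra.
apply: (le_trans (chernoff_independent_sum (a := a) Xindep
  (e := fun i => C * (b - 1) * y i `^ b) t mg l0 _)).
  move=> i; apply: g_mgf.
  have -> : C * b * (t / S) `^ (b - 1) * a i = C * b * y i `^ (b - 1).
    by rewrite yE mulrA.
  exact: exp_majorized_power.
rewrite lee_fin ler_expR -mulr_sumr yS -WE /W.
by rewrite le_eqVlt; apply/orP; left; apply/eqP; ring.
Qed.

(** With q = b / (b - 1), q - 1 = 1 / (b - 1) >= 1, so that the power q - 1 of
    the small number 8 * C is at most 8 * C, uniformly in b. *)
Lemma dual_exponent_sum_le (C l S : R) : 1 < b -> b <= 2 -> 0 < C -> 8 * C <= 1 ->
  0 < S -> 0 < l -> l <= 2 * C * (t `^ (b - 1) / S `^ (b - 1)) ->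
  (4 * l) `^ (b / (b - 1)) * S <= 32 * C * (l * t).
Proof.
move=> b1 b2 C0 C1 S0 l0; rewrite -powR_div; [|exact: ltW|exact: ltW] => lC.
have b'0 : 0 < b - 1 by lra.
have l40 : 0 <= 4 * l by lra.
have q0 : 0 < b / (b - 1) by rewrite divr_gt0//; lra.
have qE : b / (b - 1) - 1 = (b - 1)^-1 by field; rewrite gt_eqF.
have tS0 : 0 <= t / S by rewrite divr_ge0// ltW.
rewrite -mulr_powRB1// qE.
have h1 : (4 * l) `^ (b - 1)^-1 <= 8 * C * (t / S).
  apply: (@le_trans _ _ ((8 * C * (t / S) `^ (b - 1)) `^ (b - 1)^-1)).
    apply: ge0_ler_powR; rewrite ?nnegrE ?invr_ge0//; [exact: ltW| |lra].
    by rewrite mulr_ge0 ?powR_ge0//; lra.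
  rewrite powRM ?powR_ge0//; last lra.
  rewrite -powRrM divff ?gt_eqF// powRr1// ler_wpM2r//.
  by apply: ge1r_powR; [lra|rewrite invf_ge1//; lra].
have := ler_wpM2l (mulr_ge0 l40 (ltW S0)) h1.
have -> : 4 * l * S * (8 * C * (t / S)) = 32 * C * (l * t).
  by field; rewrite gt_eqF.
by rewrite mulrAC.
Qed.

(** The Laplace parameter l is 2 * C times the smaller of t / |a|_2^2 and
    t `^ (b - 1) / dual_denom b a. The first makes the sum of the quadratic
    bounds at most l t / 4, the second does so for the sum of the Young bounds,
    which leaves - l t / 2. *)
Lemma tail_mixed (C : R) : 1 <= b -> b <= 2 ->
  0 < C -> C * (100 * 100 * 100 * 100 * 100 * 100) <= 1 ->
  0 < \sum_i a i ^+ 2 -> 0 < dual_denom b a ->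
  (P [set w | (t <= \sum_i a i * g i (X i w))%R] <=
   (expR (- (C * Num.min (t ^+ 2 / \sum_i a i ^+ 2)
                         (t `^ b / dual_denom b a))))%:E)%E.
Proof.
move=> b1 b2 C0 C1; set B2 := \sum_i _ => B0; set D := dual_denom b a => D0.
pose m := Num.min (t / B2) (t `^ (b - 1) / D).
have tb : t `^ b = t `^ (b - 1) * t by rewrite mulrC mulr_powRB1 ?ltW//; lra.
have mt : Num.min (t ^+ 2 / B2) (t `^ b / D) = m * t.
  by rewrite /m minr_pMl ?(ltW t0)// tb expr2 !(mulrAC _ _ t).
have m0 : 0 < m by rewrite lt_min !divr_gt0// powR_gt0.
pose l := 2 * C * m.
have l0 : 0 < l by rewrite !mulr_gt0.
have lB : l <= 2 * C * (t / B2).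
  by apply: ler_wpM2l; [lra|rewrite ge_min lexx].
have lD : l <= 2 * C * (t `^ (b - 1) / D).
  by apply: ler_wpM2l; [lra|rewrite ge_min lexx orbT].
pose e i := 128 * 9 * (l * a i) ^+ 2 +
  (if b == 1 then 0 else 5 * (4 * (l * a i)) `^ (b / (b - 1))).
have e2 i : 0 <= (if b == 1 then 0 else 5 * (4 * (l * a i)) `^ (b / (b - 1))).
  by case: ifP => // _; rewrite mulr_ge0// powR_ge0.
have e1 i : 0 <= 128 * 9 * (l * a i) ^+ 2 by apply: mulr_ge0; [lra|exact: sqr_ge0].
have la0 i : 0 <= l * a i by rewrite mulr_ge0// ltW.
apply: (le_trans (chernoff_independent_sum (a := a) Xindep (e := e) t mg l0 _)).
  move=> i; apply: g_mgf; have [la4|la4] := lerP (l * a i) 4^-1.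
    apply: exp_majorized_le (exp_majorized_quadratic b1 _); last first.
      by rewrite ger0_norm.
    by rewrite ler_expR /e lerDl.
  (* For b = 1 the dual norm is the maximum, so that l * a i <= 2 * C. *)
  have bn1 : b != 1.
    apply/eqP => bE; have tb0 : t `^ (b - 1) = 1 by rewrite bE subrr powRr0.
    have aD : a i <= D by rewrite /D /dual_denom bE eqxx; exact: le_bigmax.
    have := ler_wpM2r (a0 i) lD; rewrite tb0.
    have : 2 * C * (1 / D) * a i <= 2 * C * 1.
      rewrite -mulrA ler_wpM2l//; first by lra.
      by rewrite mul1r mulrC ler_pdivrMr// mul1r.
    lra.
  apply: exp_majorized_le (exp_majorized_young _ _); last exact: ltW.
    by rewrite ler_expR /e (negbTE bn1) lerDr; exact: e1.
  by rewrite lt_neqAle eq_sym bn1.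
rewrite lee_fin ler_expR mt /e big_split/=.
have lt0 : 0 < l * t by rewrite mulr_gt0.
have s1 : \sum_i 128 * 9 * (l * a i) ^+ 2 <= 4^-1 * (l * t).
  under eq_bigr do rewrite exprMn mulrA.
  rewrite -mulr_sumr -/B2.
  have : l * B2 <= 2 * C * t by move: lB; rewrite mulrA ler_pdivlMr.
  move=> /(ler_wpM2l (ltW l0)).
  have : C * (l * t) * (100 * 100 * 100 * 100 * 100 * 100) <= l * t.
    by rewrite mulrAC ler_piMl// ltW.
  rewrite expr2; lra.
have s2 : \sum_i (if b == 1 then 0 else 5 * (4 * (l * a i)) `^ (b / (b - 1)))
    <= 4^-1 * (l * t).
  have [bE|bn1] := eqVneq b 1; first by rewrite big1// mulr_ge0// ltW.
  under eq_bigr do rewrite mulrA powRM ?a0// 1?mulr_ge0// ?(ltW l0)//.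
  rewrite -mulr_sumr -mulr_sumr.
  have b1' : 1 < b by rewrite lt_neqAle eq_sym bn1.
  move: lD D0; rewrite /D /dual_denom (negbTE bn1).
  set S := \sum_i _ => lD D0.
  have S0 : 0 < S.
    by apply: gt0_powR D0; [lra|apply: sumr_ge0 => i _; exact: powR_ge0].
  have C8 : 8 * C <= 1 by lra.
  have := dual_exponent_sum_le b1' b2 C0 C8 S0 l0 lD.
  have : C * (l * t) * (100 * 100 * 100 * 100 * 100 * 100) <= l * t.
    by rewrite mulrAC ler_piMl// ltW.
  lra.
have -> : - (C * (m * t)) = - (2^-1 * (l * t)) by rewrite /l; field.
lra.
Qed.

End tails.

(** * Squares of variables with a finite Orlicz norm *)

Section orlicz.
Local Open Scope ereal_scope.
Context disp (T : measurableType disp) (R : realType) (P : probability T R).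
Variables (al : R) (X : {RV P >-> R}) (K : R).
Hypothesis al2 : (2 <= al)%R.
Hypothesis XK : orlicz_norm P al X <= K%:E.

Lemma orlicz_lt (K' : R) : (K < K')%R -> exists u, [/\ (0 < u)%R, (u < K')%R &
  \int[P]_w (expR ((`|X w| / u) `^ al))%:E <= 2%:E].
Proof.
move=> KK'.
have /ereal_inf_lt[_ [u [u0 h] <-]] : orlicz_norm P al X < K'%:E.
  by apply: le_lt_trans XK _; rewrite lte_fin.
by rewrite lte_fin => uK; exists u; split => //; rewrite unlock in h.
Qed.

Lemma orlicz_ge0 : (0 <= K)%R.
Proof.
rewrite -lee_fin; apply: le_trans XK; apply: le_ereal_inf_tmp => _ [u [u0 _] <-].
by rewrite lee_fin ltW.
Qed.

Let mX : measurable_fun setT X := measurable_funPT X.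

Lemma measurable_exp_ratio (u : R) :
  measurable_fun setT (fun w => expR ((`|X w| / u) `^ al)).
Proof.
apply: measurableT_comp => //; apply: (measurableT_comp (measurable_powR al)).
by apply: measurable_funM => //; exact: measurableT_comp.
Qed.

Let mX2 : measurable_fun setT (fun w => X w ^+ 2)%R.
Proof. exact: measurable_funX. Qed.

(** From z^2 <= 1 + (z^2) `^ (al / 2) <= expR (z `^ al) with z = |X| / u. *)
Lemma second_moment_le (K' : R) : (K < K')%R ->
  \int[P]_w (X w ^+ 2)%:E <= (2 * K' ^+ 2)%:E.
Proof.
move=> KK'; have [u [u0 uK' h]] := orlicz_lt KK'.
apply: (@le_trans _ _ (\int[P]_w ((u ^+ 2)%:E * (expR ((`|X w| / u) `^ al))%:E))).
  apply: ge0_le_integral => //.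
  - by move=> w _; rewrite lee_fin sqr_ge0.
  - exact/measurable_EFinP.
  - by apply: emeasurable_funM => //; apply/measurable_EFinP;
      exact: measurable_exp_ratio.
  - move=> w _; rewrite -EFinM lee_fin.
    have -> : (X w ^+ 2 = u ^+ 2 * (`|X w| / u) ^+ 2)%R.
      by rewrite -exprMn mulrCA divff ?gt_eqF// mulr1 real_normK// num_real.
    rewrite ler_wpM2l ?sqr_ge0//.
    pose z : R := (`|X w| / u)%R; rewrite -/z; have z0 : (0 <= z)%R by rewrite divr_ge0// ltW.
    have al0 : (0 < al)%R by apply: lt_le_trans al2.
    have z2 : ((z ^+ 2) `^ (al / 2) = z `^ al)%R.
      by rewrite -powR_mulrn// -powRrM mulrCA divff// mulr1.
    have al21 : (1 <= al / 2)%R by rewrite ler_pdivlMr// mul1r.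
    have := norm_le_powR (z ^+ 2)%R al21; rewrite ger0_norm ?sqr_ge0// z2 => hz.
    apply: le_trans (expR_ge1Dx _); apply: (le_trans hz); rewrite lerD2l.
    by rewrite ler_pdivrMr ?ler_peMr ?powR_ge0// divr_gt0.
rewrite ge0_integralZl//; first last.
- by rewrite lee_fin sqr_ge0.
- by apply/measurable_EFinP; exact: measurable_exp_ratio.
apply: (@le_trans _ _ ((u ^+ 2)%:E * 2%:E)).
  by rewrite lee_wpmul2l// lee_fin sqr_ge0.
rewrite -EFinM lee_fin mulrC ler_wpM2l// ler_pXn2r// ?nnegrE ltW//.
exact: lt_trans uK'.
Qed.

Let s : R := fine (\int[P]_w (X w ^+ 2)%:E).

Lemma second_momentE : \int[P]_w (X w ^+ 2)%:E = s%:E.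
Proof.
rewrite /s fineK// ge0_fin_numE; last first.
  by apply: integral_ge0 => w _; rewrite lee_fin sqr_ge0.
have K1 : (K < K + 1)%R by rewrite ltrDl.
by apply: le_lt_trans (second_moment_le K1) _; rewrite ltry.
Qed.

Lemma second_moment_eq0 : (K = 0)%R -> (s = 0)%R.
Proof.
move=> K0; apply/eqP; rewrite eq_le; apply/andP; split; last first.
  by rewrite -lee_fin -second_momentE; apply: integral_ge0 => w _;
    rewrite lee_fin sqr_ge0.
rewrite leNgt; apply/negP => s0.
pose e := (Num.min 1 (s / 4))%R.
have e0 : (0 < e)%R by rewrite lt_min ltr01 divr_gt0.
have e1 : (e <= 1)%R by rewrite ge_min lexx.
have e2 : (e <= s / 4)%R by rewrite ge_min lexx orbT.
have : (K < e)%R by rewrite K0.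
move=> /second_moment_le; rewrite second_momentE lee_fin.
have : (e * e <= e * 1)%R by rewrite ler_pM2l.
rewrite expr2; lra.
Qed.

(** All u > 0 are then admissible, and second_moment_le forces the second
    moment to vanish. *)
Lemma ae_eq0_of_orlicz0 : (K = 0)%R -> P [set w | X w != 0%R] = 0.
Proof.
move=> /second_moment_eq0 s0.
have : \int[P]_w `|(X w ^+ 2)%:E| = 0.
  rewrite -[RHS]/(0%:E) -s0 -second_momentE.
  by apply: eq_integral => w _ /=; rewrite ger0_norm ?sqr_ge0.
have mEX2 : measurable_fun setT (fun w => (X w ^+ 2)%:E) by exact/measurable_EFinP.
move/(ae_eq_integral_abs P measurableT mEX2) => [N [mN N0 XN]].
apply: (@subset_measure0 _ _ _ P _ N) => //.
  rewrite [X in measurable X](_ : _ = X @^-1` (~` [set 0%R])).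
    by apply: measurable_funPTI; exact: measurableC.
  by apply/seteqP; split => w /= /eqP.
move=> w /= Xw; apply: XN => /= /(_ Logic.I) /eqP.
by rewrite eqe sqrf_eq0 (negbTE Xw).
Qed.

Hypothesis K0 : (0 < K)%R.

(** The factor 1/2 in the exponent amounts to enlarging K by 2 `^ al^-1 > 1,
    which makes room for an admissible u. Its cost in the final bound is a
    constant factor, uniformly in al. *)
Lemma orlicz_exp_half : \int[P]_w (expR ((`|X w| / K) `^ al / 2))%:E <= 2%:E.
Proof.
have al0 : (0 < al)%R by apply: lt_le_trans al2.
pose r : R := (2 `^ al^-1)%R.
have r0 : (0 < r)%R by rewrite powR_gt0.
have r1 : (1 < r)%R.
  rewrite -(powRr0 2) /r /powR pnatr_eq0/= ltr_expR mul0r.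
  by rewrite mulr_gt0 ?invr_gt0// ln_gt0// ltr1n.
have rE : (r `^ al = 2)%R by rewrite -powRrM mulVf ?gt_eqF// powRr1.
have Kr : (K < r * K)%R by rewrite ltr_pMl.
have [u [u0 ur h]] := orlicz_lt Kr.
apply: le_trans h; apply: ge0_le_integral => //.
- apply/measurable_EFinP; apply: measurable_expR_powR.
  by apply: measurable_funM => //; exact: measurableT_comp.
- by apply/measurable_EFinP; exact: measurable_exp_ratio.
move=> w _; rewrite lee_fin ler_expR.
have -> : ((`|X w| / K) `^ al / 2 = (`|X w| / (r * K)) `^ al)%R.
  rewrite invfM mulrCA [LHS]mulrC [RHS]powRM ?invr_ge0 ?(ltW r0)//; last first.
    by rewrite divr_ge0// ltW.
  congr (_ * _)%R.
  by rewrite -rE -(powR_inv1 (ltW r0)) -powRrM mulN1r powRN.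
apply: ge0_ler_powR; first exact: ltW.
- by rewrite nnegrE divr_ge0// ltW// mulr_gt0.
- by rewrite nnegrE divr_ge0// ltW.
- by rewrite ler_wpM2l// lef_pV2 ?posrE ?mulr_gt0// ltW.
Qed.

Let b : R := (al / 2)%R.
Let b1 : (1 <= b)%R. Proof. by rewrite ler_pdivlMr// mul1r. Qed.

Lemma ratio_sqr_powR (x : R) :
  ((x ^+ 2 / K ^+ 2) `^ b = (`|x| / K) `^ al)%R.
Proof.
rewrite -real_normK ?num_real// -expr_div_n -powR_mulrn ?divr_ge0 ?(ltW K0)//.
by rewrite -powRrM /b mulrCA divff// mulr1.
Qed.

(** Jensen's inequality for the convex function z |-> expR (z `^ b / 2), by
    integrating the tangent at the mean of X^2 / K^2. *)
Lemma exp_variance_le2 : (expR ((s / K ^+ 2) `^ b / 2) <= 2)%R.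
Proof.
set m := (s / K ^+ 2)%R.
have K20 : (0 < K ^+ 2)%R by rewrite exprn_gt0.
have s0 : (0 <= s)%R.
  by rewrite -lee_fin -second_momentE; apply: integral_ge0 => w _;
    rewrite lee_fin sqr_ge0.
have m0 : (0 <= m)%R by rewrite divr_ge0// ltW.
pose e0 := expR (m `^ b / 2).
pose k := (b * m `^ (b - 1) / 2)%R.
have iX2 : P.-integrable setT (EFin \o (fun w => X w ^+ 2)%R).
  apply: ge0_integrable => //; first by move=> w; exact: sqr_ge0.
  by rewrite second_momentE ltry.
have [iA EA] := integral_affine (e0 * (1 - k * m))%R (e0 * k / K ^+ 2)%R
  iX2 second_momentE.
rewrite -lee_fin; apply: le_trans orlicz_exp_half.
have -> : (expR (m `^ b / 2))%:E =
    (e0 * (1 - k * m) + e0 * k / K ^+ 2 * s)%:E.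
  by congr EFin; rewrite /m -/e0; field; rewrite gt_eqF.
rewrite -EA; apply: le_integral => //.
  apply: ge0_integrable; last 2 first.
  - by move=> w; exact: expR_ge0.
  - by apply: le_lt_trans orlicz_exp_half _; rewrite ltry.
  apply: measurable_expR_powR.
  by apply: measurable_funM => //; exact: measurableT_comp.
move=> w _; rewrite lee_fin -ratio_sqr_powR.
set z := (X w ^+ 2 / K ^+ 2)%R.
have z0 : (0 <= z)%R by rewrite divr_ge0 ?sqr_ge0.
have tang := powR_tangent z0 m0 b1.
apply: (@le_trans _ _ (e0 * (1 + (z `^ b / 2 - m `^ b / 2)))%R).
  have -> : (e0 * (1 - k * m) + e0 * k / K ^+ 2 * X w ^+ 2 =
    e0 * (1 + k * (z - m)))%R.
    by rewrite /z; field; rewrite gt_eqF.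
  by apply: ler_wpM2l; [exact: expR_ge0|rewrite /k; lra].
have -> : expR (z `^ b / 2) = (e0 * expR (z `^ b / 2 - m `^ b / 2))%R.
  by rewrite -expRD; congr expR; ring.
by apply: ler_wpM2l; [exact: expR_ge0|exact: expR_ge1Dx].
Qed.

(** |z - m| <= max z m for nonnegative z and m, so that the exponential moment
    is at most the sum of those of z = X^2 / K^2 and of its mean m. *)
Lemma centered_square_exp_moment :
  \int[P]_w (expR (`|(X w ^+ 2 - s) / K ^+ 2| `^ b / 2))%:E <= 4%:E.
Proof.
have K20 : (0 < K ^+ 2)%R by rewrite exprn_gt0.
have s0 : (0 <= s)%R.
  by rewrite -lee_fin -second_momentE; apply: integral_ge0 => w _;
    rewrite lee_fin sqr_ge0.
set m := (s / K ^+ 2)%R; have m0 : (0 <= m)%R by rewrite divr_ge0// ltW.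
have b0 : (0 <= b)%R by apply: le_trans b1.
have mexp : measurable_fun setT (fun w => expR ((`|X w| / K) `^ al / 2)).
  apply: measurable_expR_powR.
  by apply: measurable_funM => //; exact: measurableT_comp.
apply: (@le_trans _ _ (\int[P]_w ((expR ((`|X w| / K) `^ al / 2))%:E + 2%:E))).
  apply: ge0_le_integral => //.
  - apply/measurable_EFinP; apply: measurable_expR_powR.
    apply: measurableT_comp => //; apply: measurable_funM => //.
    exact: measurable_funB.
  - by apply: emeasurable_funD => //; exact/measurable_EFinP.
  - move=> w _; rewrite -EFinD lee_fin -ratio_sqr_powR mulrBl -/m.
    set z := (X w ^+ 2 / K ^+ 2)%R.
    have z0 : (0 <= z)%R by rewrite divr_ge0 ?sqr_ge0.
    have e2 := exp_variance_le2; rewrite -/m in e2.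
    have [zm|mz] := lerP m z.
      apply: ler_wpDr => //; rewrite ler_expR ler_pM2r// ge0_ler_powR ?nnegrE//.
        by rewrite subr_ge0.
      by rewrite gerBl.
    apply: ler_wpDl; first exact: expR_ge0.
    apply: le_trans e2; rewrite ler_expR ler_pM2r// ge0_ler_powR ?nnegrE//.
      by rewrite subr_ge0 ltW.
    by rewrite gerBl.
rewrite ge0_integralD//; last exact/measurable_EFinP.
rewrite integral_cst//.
set p := (X in 2%:E * X); have -> : p = 1 by exact: probability_setT.
have -> : 4%:E = 2%:E + 2%:E :> \bar R by rewrite -EFinD; congr EFin; ring.
by rewrite mule1 leeD2r// orlicz_exp_half.
Qed.
End orlicz.

Section centered_square.
Local Open Scope ereal_scope.
Context disp (T : measurableType disp) (R : realType) (P : probability T R).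
Variables (al : R) (X : {RV P >-> R}) (K : R).
Hypothesis al2 : (2 <= al)%R.
Hypothesis XK : orlicz_norm P al X <= K%:E.

Let s : R := fine (\int[P]_w (X w ^+ 2)%:E).
Let mX : measurable_fun setT X := measurable_funPT X.

(** v^2 <= 1 + v `^ (al / 2) since al / 2 >= 2, and expR (1 / 2) <= 2. *)
Lemma centered_square_exp_moment_sqr : (4 <= al)%R -> (0 < K)%R ->
  \int[P]_w (expR (`|(X w ^+ 2 - s) / K ^+ 2| `^ 2 / 2))%:E <= 9%:E.
Proof.
move=> al4 K0; have h := centered_square_exp_moment al2 XK K0.
have b1 : (1 <= al / 2 / 2)%R by rewrite !ler_pdivlMr//; lra.
have mU (r : R) : measurable_fun setT
    (fun w => expR (`|(X w ^+ 2 - s) / K ^+ 2| `^ r / 2))%R.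
  apply: measurable_expR_powR.
  apply: measurableT_comp => //; apply: measurable_funM => //.
  by apply: measurable_funB => //; exact: measurable_funX.
apply: (@le_trans _ _ (\int[P]_w
    (2%:E * (expR (`|(X w ^+ 2 - s) / K ^+ 2| `^ (al / 2) / 2))%:E))).
  apply: ge0_le_integral => //.
  - exact/measurable_EFinP.
  - by apply: emeasurable_funM => //; exact/measurable_EFinP.
  move=> w _; rewrite -EFinM lee_fin.
  set v := (`|_|)%R; have v0 : (0 <= v)%R by exact: normr_ge0.
  apply: le_trans (ler_wpM2r (expR_ge0 _) (expR_half_le2 R)).
  rewrite -expRD ler_expR.
  have v2 : ((v `^ 2) `^ (al / 2 / 2) = v `^ (al / 2))%R.
    by rewrite -powRrM mulrCA divff// mulr1.
  have := norm_le_powR (v `^ 2)%R b1; rewrite ger0_norm ?powR_ge0// v2.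
  have : (v `^ (al / 2) / (al / 2 / 2) <= v `^ (al / 2))%R.
    by rewrite ler_pdivrMr ?ler_peMr ?powR_ge0//; lra.
  move: (v `^ 2)%R (v `^ (al / 2))%R (al / 2 / 2)%R => p q r; lra.
rewrite ge0_integralZl//; last exact/measurable_EFinP.
apply: (@le_trans _ _ (2%:E * 4%:E)); first by rewrite lee_wpmul2l.
by rewrite -EFinM lee_fin; lra.
Qed.

(** For K = 0 the variable is identically 0, since division by 0 gives 0. *)
Lemma centered_square_mgf (b e x E : R) : `|e|%R = 1%R ->
  b = (al / 2)%R \/ (4 <= al)%R /\ b = 2%R -> exp_majorized b x E ->
  \int[P]_w (expR (x * (e * ((X w ^+ 2 - s) / K ^+ 2))))%:E <= E%:E.
Proof.
move=> e1 bE; have sE : \int[P]_w (X w ^+ 2)%:E = s%:E := second_momentE al2 XK.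
have iX2 : P.-integrable setT (EFin \o (fun w => X w ^+ 2)%R).
  apply: ge0_integrable => //; first exact: measurable_funX.
    by move=> w; exact: sqr_ge0.
  by rewrite sE ltry.
have [iU EU] := integral_affine (- (e * s / K ^+ 2))%R (e / K ^+ 2)%R iX2 sE.
have UE w : (e * ((X w ^+ 2 - s) / K ^+ 2) =
    - (e * s / K ^+ 2) + e / K ^+ 2 * X w ^+ 2)%R by ring.
apply: (le_integral_of_bounded_exp (U := fun w => e * ((X w ^+ 2 - s) / K ^+ 2))%R).
- by rewrite /comp; under eq_fun do rewrite UE; exact: iU.
- by under eq_integral do rewrite UE; rewrite EU; congr EFin; ring.
have K0 := orlicz_ge0 XK.
under eq_integral do rewrite normrM e1 mul1r.
have [->|Kn0] := eqVneq K 0%R.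
  under eq_integral do rewrite expr0n invr0 mulr0 normr0.
  rewrite powR0; last first.
    case: bE => [->|[_ ->]]; apply: lt0r_neq0 => //.
    by rewrite divr_gt0//; exact: lt_le_trans al2.
  rewrite mul0r expR0 integral_cst//.
  set p := (X in 1%:E * X); have -> : p = 1 by exact: probability_setT.
  by rewrite mule1 lee_fin; lra.
have K_gt0 : (0 < K)%R by rewrite lt_neqAle eq_sym Kn0.
case: bE => [->|[al4 ->]]; last exact: centered_square_exp_moment_sqr.
apply: le_trans (centered_square_exp_moment al2 XK K_gt0) _.
by rewrite lee_fin; lra.
Qed.

End centered_square.

(** * From the norm to its square *)

(** Factor the difference of squares: x + y is at least y and |x - y|. *)
Lemma le_sqr_diff (R : realType) (x y s : R) : 0 <= x -> 0 <= y -> 0 <= s ->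
  s <= `|x - y| -> s * Num.max s y <= `|x ^+ 2 - y ^+ 2|.
Proof.
move=> x0 y0 s0 sxy; rewrite subr_sqr normrM.
apply: ler_pM => //; first by rewrite le_max s0.
rewrite [leRHS]ger0_norm ?addr_ge0// ge_max lerDr x0 andbT.
by apply: (le_trans sxy); rewrite ler_norml; lra.
Qed.

Section norm_deviation.
Local Open Scope ereal_scope.
Context disp (T : measurableType disp) (R : realType) (P : probability T R).
Variables (al : R) (d : nat) (X : 'I_d -> {RV P >-> R}) (K : 'I_d -> R).
Hypothesis al2 : (2 <= al)%R.
Hypothesis XK : forall i, orlicz_norm P al (X i) <= (K i)%:E.

Definition second_moment (i : 'I_d) : R := fine (\int[P]_w (X i w ^+ 2)%:E).

Definition centered_square (e : R) (i : 'I_d) (y : R) : R :=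
  (e * ((y ^+ 2 - second_moment i) / K i ^+ 2))%R.

Lemma second_moment_ge0 i : (0 <= second_moment i)%R.
Proof.
by apply: fine_ge0; apply: integral_ge0 => w _; rewrite lee_fin sqr_ge0.
Qed.

Lemma sqr_sigma i : (sigma P (X i) ^+ 2 = second_moment i)%R.
Proof. by rewrite /sigma sqr_sqrtr unlock// second_moment_ge0. Qed.

Lemma sqr_enorm w :
  (enorm (\row_(i < d) X i w) ^+ 2 = \sum_i X i w ^+ 2)%R.
Proof.
rewrite /enorm sqr_sqrtr; last by apply: sumr_ge0 => i _; exact: sqr_ge0.
by apply: eq_bigr => i _; rewrite mxE.
Qed.

Lemma expectation_sqr_enorm :
  'E_P[(fun w => enorm (\row_(i < d) X i w) ^+ 2)%R] =
  (\sum_i second_moment i)%:E.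
Proof.
rewrite unlock; under eq_integral do rewrite sqr_enorm -sumEFin.
rewrite ge0_integral_sum//.
- by rewrite -sumEFin; apply: eq_bigr => i _; exact: second_momentE al2 (XK i).
- by move=> i; apply/measurable_EFinP; exact: measurable_funX.
- by move=> i w _; rewrite lee_fin sqr_ge0.
Qed.

(* Where some X i with K i = 0 does not vanish: off this null set the squared
   norm is recovered from the centered squares. *)
Let N : set T := \big[setU/set0]_(i < d)
  (if K i == 0%R then [set w | X i w != 0%R] else set0).

Lemma null_zero_scale : measurable N /\ P N = 0.
Proof.
rewrite /N; apply: (big_ind (fun A => measurable A /\ P A = 0)).
- by split => //; exact: measure0.
- move=> A A' [mA A0] [mA' A'0]; split; first exact: measurableU.
  have h : P A + P A' = 0 by rewrite A0 A'0 adde0.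
  by apply/eqP; rewrite -measure_le0 -[leRHS]h; exact: measureU2.
- move=> i _; case: ifPn => [/eqP Ki0|_]; last by split => //; exact: measure0.
  split; last exact: ae_eq0_of_orlicz0 al2 (XK i) Ki0.
  rewrite (_ : mkset _ = X i @^-1` (~` [set 0%R])).
    by apply: measurable_funPTI; exact: measurableC.
  by apply/seteqP; split => w /= /eqP.
Qed.

Lemma sum_centered_square e w : ~ N w ->
  (\sum_i K i ^+ 2 * centered_square e i (X i w) =
   e * (\sum_i X i w ^+ 2 - \sum_i second_moment i))%R.
Proof.
move=> Nw; rewrite -sumrB mulr_sumr; apply: eq_bigr => i _.
rewrite /centered_square; have [Ki0|Ki0] := eqVneq (K i) 0%R.
  have X0 : X i w = 0%R.
    apply/eqP; apply/negP => /negP Xw; apply: Nw.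
    by rewrite /N (bigD1 i)//= Ki0 eqxx; left.
  have m0 : second_moment i = 0%R := second_moment_eq0 al2 (XK i) Ki0.
  by rewrite m0 X0 Ki0 expr0n/= subrr mul0r mulr0.
by rewrite mulrCA; congr (_ * _)%R; rewrite mulrCA divff ?mulr1// sqrf_eq0.
Qed.

Lemma measurable_sum_centered_square e t :
  measurable [set w | (t <= \sum_i K i ^+ 2 * centered_square e i (X i w))%R].
Proof.
have mS : measurable_fun setT
    (fun w => \sum_i K i ^+ 2 * centered_square e i (X i w))%R.
  apply: measurable_sum => i; apply: measurable_funM => //.
  apply: measurable_funM => //; apply: measurable_funM => //.
  by apply: measurable_funB => //; exact: measurable_funX.
rewrite (_ : [set w | _] = setT `&` (fun w => \sum_i K i ^+ 2 *
    centered_square e i (X i w))%R @^-1` `[t, +oo[%classic).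
  by apply: mS => //; exact: measurable_itv.
by rewrite setTI; apply/seteqP; split => w /=; rewrite in_itv/= andbT.
Qed.

Lemma measurable_norm_deviation (s c : R) :
  measurable [set w | (s <= `|enorm (\row_(i < d) X i w) - c|)%R].
Proof.
have mS : measurable_fun setT (fun w => `|enorm (\row_(i < d) X i w) - c|)%R.
  apply: measurableT_comp => //; apply: measurable_funB => //.
  apply: (measurableT_comp (f := @Num.sqrt R)).
    by apply: continuous_measurable_fun; exact: sqrt_continuous.
  under eq_fun do under eq_bigr do rewrite mxE.
  by apply: measurable_sum => i; exact: measurable_funX.
rewrite (_ : [set w | _] = setT `&`
    (fun w => `|enorm (\row_(i < d) X i w) - c|)%R @^-1` `[s, +oo[%classic).
  by apply: mS => //; exact: measurable_itv.
by rewrite setTI; apply/seteqP; split => w /=; rewrite in_itv/= andbT.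
Qed.

(** Up to a null set, the deviation of the norm splits into the upper (e = 1)
    and the lower (e = - 1) deviation of the sum of the centered squares. *)
Lemma norm_deviation_le (s : R) (p : \bar R) : (0 <= s)%R ->
  let S2 := (\sum_i second_moment i)%R in
  (forall e : R, `|e|%R = 1%R ->
    P [set w | (s * Num.max s (Num.sqrt S2) <=
      \sum_i K i ^+ 2 * centered_square e i (X i w))%R] <= p) ->
  P [set w | (s <= `|enorm (\row_(i < d) X i w) - Num.sqrt S2|)%R] <= 2%:E * p.
Proof.
move=> s0 S2 tail; set t := (s * _)%R in tail.
have S20 : (0 <= S2)%R by apply: sumr_ge0 => i _; exact: second_moment_ge0.
pose E e := [set w | (t <= \sum_i K i ^+ 2 * centered_square e i (X i w))%R].
have mE e : measurable (E e) := measurable_sum_centered_square e t.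
have [mN N0] := null_zero_scale.
apply: (@le_trans _ _ (P (E 1%R `|` E (-1)%R `|` N))).
  apply: le_measure; rewrite ?inE; first exact: measurable_norm_deviation.
    by apply: measurableU => //; exact: measurableU.
  move=> w /= sw; have [Nw|Nw] := pselect (N w); [by right|left].
  have := le_sqr_diff (sqrtr_ge0 _) (sqrtr_ge0 _) s0 sw.
  rewrite sqr_enorm sqr_sqrtr// -/t /E /= !sum_centered_square// mul1r mulN1r.
  by rewrite ler_normr => /orP.
apply: (@le_trans _ _ (P (E 1%R `|` E (-1)%R) + P N)).
  by apply: measureU2 => //; exact: measurableU.
rewrite N0 adde0; apply: (@le_trans _ _ (P (E 1%R) + P (E (-1)%R))).
  exact: measureU2.
rewrite (_ : 2%:E = 1 + 1); last by rewrite -EFinD; congr EFin; ring.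
rewrite ge0_muleDl// mul1e; apply: leeD; apply: tail.
  exact: normr1.
by rewrite normrN1.
Qed.

End norm_deviation.

(** * Both tails in the scales of the theorem *)

Lemma dual_denom_sqr (R : realType) (al : R) (d : nat) (K : 'I_d -> R) :
  2 <= al -> (forall i, 0 <= K i) ->
  dual_denom (al / 2) (fun i => K i ^+ 2) = Kdenom al K.
Proof.
move=> al2 K0; rewrite /dual_denom /Kdenom.
have -> : (al / 2 == 1) = (al == 2).
  by apply/eqP/eqP => h; [lra|rewrite h divff].
have [//|aln2] := eqVneq al 2.
have -> : al / 2 - 1 = (al - 2) / 2 by field.
congr (_ `^ _); apply: eq_bigr => i _.
rewrite -powR_mulrn// -powRrM; congr (_ `^ _); field.
by rewrite subr_eq0.
Qed.

Lemma dual_denom2 (R : realType) (d : nat) (a : 'I_d -> R) :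
  (forall i, 0 <= a i) -> dual_denom 2 a = \sum_(i < d) a i ^+ 2.
Proof.
move=> a0; rewrite /dual_denom gt_eqF; last lra.
have -> : 2 - 1 = 1 :> R by lra.
rewrite divr1 powRr1; last by apply: sumr_ge0 => i _; exact: powR_ge0.
by apply: eq_bigr => i _; rewrite powR_mulrn.
Qed.

Lemma sum_powR_gt0 (R : realType) (d : nat) (a : 'I_d -> R) (i : 'I_d) (q : R) :
  0 < a i -> 0 < \sum_(i < d) a i `^ q.
Proof.
move=> ai; rewrite (bigD1 i)//= ltr_pwDl ?powR_gt0//.
by apply: sumr_ge0 => j _; exact: powR_ge0.
Qed.

Lemma dual_denom_gt0 (R : realType) (b : R) (d : nat) (a : 'I_d -> R)
  (i : 'I_d) : 0 < a i -> 0 < dual_denom b a.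
Proof.
move=> ai; rewrite /dual_denom; case: ifPn => _.
  exact: lt_le_trans ai (le_bigmax _ _ _).
by rewrite powR_gt0// (sum_powR_gt0 _ ai).
Qed.

Lemma deviation_scales (R : realType) (s S2 al : R) : 0 <= s -> 0 <= S2 ->
  2 <= al -> let t := s * Num.max s (Num.sqrt S2) in
  [/\ s ^+ 4 <= t ^+ 2, S2 * s ^+ 2 <= t ^+ 2, s `^ al <= t `^ (al / 2) &
      s `^ (al / 2) * S2 `^ (al / 4) <= t `^ (al / 2)].
Proof.
move=> s0 S20 al2 t.
have r0 : 0 <= Num.sqrt S2 := sqrtr_ge0 _.
have st : s * s <= t by rewrite ler_wpM2l// le_max lexx.
have rt : s * Num.sqrt S2 <= t by rewrite ler_wpM2l// le_max lexx orbT.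
have ss0 : 0 <= s * s by rewrite mulr_ge0.
have sr0 : 0 <= s * Num.sqrt S2 by rewrite mulr_ge0.
have t0 : 0 <= t by exact: le_trans st.
have al0 : 0 <= al / 2 by rewrite divr_ge0//; lra.
split.
- have -> : s ^+ 4 = (s * s) ^+ 2 by rewrite -expr2 -exprM.
  by rewrite lerXn2r.
- have -> : S2 * s ^+ 2 = (s * Num.sqrt S2) ^+ 2.
    by rewrite exprMn sqr_sqrtr// mulrC.
  by rewrite lerXn2r.
- have -> : s `^ al = (s * s) `^ (al / 2).
    by rewrite -expr2 -powR_mulrn// -powRrM mulrCA divff// mulr1.
  by apply: ge0_ler_powR; rewrite ?nnegrE.
- have -> : s `^ (al / 2) * S2 `^ (al / 4) = (s * Num.sqrt S2) `^ (al / 2).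
    by rewrite powRM// -powR12_sqrt// -powRrM; congr (_ * _ `^ _); field.
  by apply: ge0_ler_powR; rewrite ?nnegrE.
Qed.

Lemma le_two_expeR (R : realType) (p : \bar R) (C m q : R) : 0 <= C -> m <= q ->
  (p <= 2%:E * (expR (- (C * q)))%:E -> p <= 2%:E * expeR (- (C%:E * m%:E)))%E.
Proof.
move=> C0 mq /le_trans; apply.
by rewrite lee_wpmul2l// lee_fin ler_expR lerN2 ler_wpM2l.
Qed.

Section real_tail.
Local Open Scope ereal_scope.
Context disp (T : measurableType disp) (R : realType) (P : probability T R).
Variables (al : R) (d : nat) (X : 'I_d -> {RV P >-> R}) (K : 'I_d -> R).
Hypothesis al2 : (2 <= al)%R.
Hypothesis Xindep : mutually_independent X.
Hypothesis XK : forall i, orlicz_norm P al (X i) <= (K i)%:E.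
Variables (C s : R).
Hypothesis C0 : (0 < C)%R.
Hypothesis C1 : (C * (100 * 100 * 100 * 100 * 100 * 100) <= 1)%R.
Hypothesis s0 : (0 < s)%R.

Let S2 : R := (\sum_i second_moment X i)%R.
Let t : R := (s * Num.max s (Num.sqrt S2))%R.
Let prob : \bar R :=
  P [set w | (s <= `|enorm (\row_(i < d) X i w) - Num.sqrt S2|)%R].

Let t0 : (0 < t)%R. Proof. by rewrite mulr_gt0// lt_max s0. Qed.
Let K0 i : (0 <= K i)%R := orlicz_ge0 (XK i).
Let a0 i : (0 <= K i ^+ 2)%R := sqr_ge0 _.
Let mg e i : measurable_fun setT (centered_square X K e i).
Proof.
apply: measurable_funM => //; apply: measurable_funM => //.
by apply: measurable_funB => //; exact: measurable_funX.
Qed.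

Lemma norm_deviation_eq0 : (forall i, K i = 0%R) -> prob = 0.
Proof.
move=> K00; apply/eqP; rewrite -measure_le0.
rewrite (_ : 0 = 2%:E * 0); last by rewrite mule0.
apply: (norm_deviation_le al2 XK (ltW s0)) => e e1.
rewrite (_ : [set w | _] = set0) ?measure0//.
apply/seteqP; split => w //=; rewrite [leRHS]big1; last first.
  by move=> i _; rewrite K00 expr0n mul0r.
by rewrite leNgt t0.
Qed.

Hypothesis Kpos : exists i, (0 < K i)%R.

Let dpos b : (0 < dual_denom b (fun i => K i ^+ 2))%R.
Proof.
by have [i Ki] := Kpos; apply: (@dual_denom_gt0 _ _ _ _ i); rewrite exprn_gt0.
Qed.

Let K4E : (\sum_i (K i ^+ 2) ^+ 2 = \sum_i K i ^+ 4)%R.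
Proof. by apply: eq_bigr => i _; rewrite -exprM. Qed.

Let K4pos : (0 < \sum_i (K i ^+ 2) ^+ 2)%R.
Proof. by rewrite -dual_denom2. Qed.

Lemma norm_deviation_mixed : (al <= 4)%R -> prob <= 2%:E * (expR (- (C *
  Num.min (t ^+ 2 / \sum_i K i ^+ 4) (t `^ (al / 2) / Kdenom al K))))%:E.
Proof.
move=> al4; apply: (norm_deviation_le al2 XK (ltW s0)) => e e1.
rewrite -K4E -dual_denom_sqr//.
apply: (tail_mixed Xindep (g := centered_square X K e)) => //.
- by move=> i x E; apply: (centered_square_mgf al2 (XK i) e1); left.
- by rewrite ler_pdivlMr// mul1r.
- by rewrite ler_pdivrMr//; lra.
Qed.

(** For al >= 4, the exponential moment of order al / 2 >= 2 bounds the one of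
    order 2, and for b = 2 both terms of the minimum are
    t^2 / \sum_i K_i^4. *)
Lemma norm_deviation_gaussian : (4 <= al)%R ->
  prob <= 2%:E * (expR (- (C * (t ^+ 2 / \sum_i K i ^+ 4))))%:E.
Proof.
move=> al4; apply: (norm_deviation_le al2 XK (ltW s0)) => e e1.
have := @tail_mixed _ _ _ P d X Xindep 2%R (centered_square X K e)
  (fun i => K i ^+ 2)%R t (mg e) _ a0 t0 C _ _ C0 C1 K4pos (dpos _).
rewrite dual_denom2// (powR_mulrn _ (ltW t0)) minxx K4E; apply; try lra.
by move=> i x E; apply: (centered_square_mgf al2 (XK i) e1); right.
Qed.

Lemma norm_deviation_power : (4 <= al)%R ->
  prob <= 2%:E * (expR (- (C * (t `^ (al / 2) / Kdenom al K))))%:E.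
Proof.
move=> al4; apply: (norm_deviation_le al2 XK (ltW s0)) => e e1.
rewrite -dual_denom_sqr//.
apply: (tail_power Xindep (g := centered_square X K e)) => //.
- by move=> i x E; apply: (centered_square_mgf al2 (XK i) e1); left.
- by rewrite ler_pdivlMr//; lra.
- by have [i Ki] := Kpos; apply: (sum_powR_gt0 (i := i)); rewrite exprn_gt0.
Qed.

End real_tail.

(* The quotients below are taken in \bar R, where x / 0 = +oo for x > 0 and
   0 / 0 = 0; this matters only if every K i is 0. *)
Theorem theorem5 (R : realType) :
  exists C : R, 0 < C /\
  forall (alpha : R) (disp : measure_display) (T : measurableType disp)
    (P : probability T R) (d : nat) (X : 'I_d -> {RV P >-> R}) (K : 'I_d -> R),
  2 <= alpha ->
  mutually_independent X ->
  (forall i, 'E_P[X i] = 0)%E ->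
  (forall i, (orlicz_norm P alpha (X i) <= (K i)%:E)%E) ->
  forall s : R, 0 <= s ->
  let normX := fun w => enorm (\row_(i < d) X i w) in
  let prob := P [set w | s <=
    `|normX w - Num.sqrt (fine 'E_P[(fun w' => normX w' ^+ 2)])|] in
  let S2 := \sum_(i < d) sigma P (X i) ^+ 2 in
  let K4 := \sum_(i < d) K i ^+ 4 in
  let Ka := Kdenom alpha K in
  (4 <= alpha ->
    (prob <= 2%:E * expeR (- (C%:E *
      maxe (maxe (maxe
        ((s ^+ 4)%:E / K4%:E)
        (S2%:E / K4%:E * (s ^+ 2)%:E))
        ((s `^ alpha)%:E / Ka%:E))
        ((s `^ (alpha / 2) * S2 `^ (alpha / 4))%:E / Ka%:E))))%E) /\
  (alpha <= 4 ->
    (prob <= 2%:E * expeR (- (C%:E *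
      mine
        (maxe ((s ^+ 4)%:E / K4%:E)
              (S2%:E / K4%:E * (s ^+ 2)%:E))
        (maxe ((s `^ alpha)%:E / Ka%:E)
              ((s `^ (alpha / 2) * S2 `^ (alpha / 4))%:E / Ka%:E)))))%E).
Proof.
have [C [C0 C1]] : exists C : R,
    0 < C /\ C * (100 * 100 * 100 * 100 * 100 * 100) <= 1.
  have [N NE] : exists N : R, N = 100 * 100 * 100 * 100 * 100 * 100 by eexists.
  have N0 : 0 < N by rewrite NE; lra.
  by exists N^-1; rewrite invr_gt0 -NE mulVf// gt_eqF.
exists C; split=> // al disp T P d X K al2 Xindep _ XK s s0 normX prob S2 K4 Ka.
have S2E : S2 = \sum_i second_moment X i.
  by apply: eq_bigr => i _; exact: sqr_sigma.
have probE : prob = P [set w | s <=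
    `|enorm (\row_(i < d) X i w) - Num.sqrt (\sum_i second_moment X i)|].
  by rewrite /prob /normX (expectation_sqr_enorm al2 XK).
rewrite {}probE {prob normX}; set prob := P _.
(* For s = 0 all exponents vanish and the bound is 2. *)
have [s_eq0|s_neq0] := eqVneq s 0.
  have prob1 : (prob <= 2%:E * expeR (- (C%:E * 0)))%E.
    rewrite mule0 oppe0 expeR0 mule1; apply: (@le_trans _ _ 1%E).
      exact/probability_le1/measurable_norm_deviation.
    by rewrite lee_fin; lra.
  rewrite s_eq0 !powR0 ?gt_eqF ?divr_gt0//; [|lra..].
  by rewrite !expr0n/= !mul0r !mul0e !mule0 !maxxx minxx.
have s_gt0 : 0 < s by rewrite lt_neqAle eq_sym s_neq0.
have [Kpos|K0] := pselect (exists i, 0 < K i); last first.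
  have prob0 : prob = 0%E.
    apply: (norm_deviation_eq0 al2 XK s_gt0) => i; apply/eqP.
    rewrite eq_le (orlicz_ge0 (XK i)) andbT leNgt; apply/negP => Ki.
    by apply: K0; exists i.
  by rewrite prob0; split=> _; rewrite mule_ge0// expeR_ge0.
have K4_gt0 : 0 < K4.
  have [i Ki] := Kpos; rewrite /K4 (bigD1 i)//= ltr_pwDl ?exprn_gt0//.
  by apply: sumr_ge0 => j _; rewrite exprn_even_ge0.
have Ka_gt0 : 0 < Ka.
  rewrite /Ka -dual_denom_sqr//; last by move=> i; exact: orlicz_ge0 (XK i).
  by have [i Ki] := Kpos; apply: (@dual_denom_gt0 _ _ _ _ i); rewrite exprn_gt0.
have S20 : 0 <= S2 by apply: sumr_ge0 => i _; exact: sqr_ge0.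
have [t1 t2 t3 t4] := deviation_scales s0 S20 al2.
rewrite !inver !gt_eqF// -!EFinM -!EFin_max -EFin_min.
set t := s * _ in t1 t2 t3 t4.
have h1 : Num.max (s ^+ 4 / K4) (S2 / K4 * s ^+ 2) <= t ^+ 2 / K4.
  by rewrite (mulrAC S2) ge_max; apply/andP; split; rewrite ler_pM2r ?invr_gt0.
have h2 : Num.max (s `^ al / Ka) (s `^ (al / 2) * S2 `^ (al / 4) / Ka) <=
    t `^ (al / 2) / Ka.
  by rewrite ge_max; apply/andP; split; rewrite ler_pM2r ?invr_gt0.
split=> al4; last first.
  apply: le_two_expeR (ltW C0) _ (norm_deviation_mixed al2 Xindep XK C0 C1 s_gt0 Kpos al4).
  by rewrite -S2E -/t le_min !ge_min h1 h2 orbT.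
(* The larger of the two scales decides which bound to use. *)
rewrite -maxA; have [h|h] := lerP (t ^+ 2 / K4) (t `^ (al / 2) / Ka).
  apply: le_two_expeR (ltW C0) _ (norm_deviation_power al2 Xindep XK C0 C1 s_gt0 Kpos al4).
  by rewrite -S2E -/t ge_max h2 (le_trans h1).
apply: le_two_expeR (ltW C0) _ (norm_deviation_gaussian al2 Xindep XK C0 C1 s_gt0 Kpos al4).
by rewrite -S2E -/t ge_max h1 (le_trans h2)// ltW.
Qed.
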